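(* Let $r>0$, $P_0>0$, and consider, for $\epsilon>0$, the Gaussian sequence model $y_j=a_jx_j+\epsilon\sigma_j\xi_j$, $j\ge1$, described in the context, with the a priori information $x\in B^r_{2\infty}$. Assume that there are $j_0$ and constants $c,C$ such that: (i) $|a_j/a_{j+1}|\ge1$ for all $j>j_0$; (ii) $0<c<\sigma_j^2<C<\infty$ for all $j$; (iii) for all $j>j_0$, $$\frac{\sigma_j^2\,a_{j-1}^2\,j^{2r+1}}{\sigma_{j-1}^2\,a_j^2\,(j-1)^{2r+1}}>1 .$$ Then the (Tikhonov regularization) estimator $\hat x_\epsilon=\{\lambda_jy_j\}_{j=1}^\infty$ with $$\lambda_j=a_j^{-1}\,\frac{a_j^2}{a_j^2+(2rP_0)^{-1}\epsilon^2\sigma_j^2j^{2r+1}},\qquad j\ge1,$$ is asymptotically minimax in the class of all estimators, i.e. $$\sup_{x\in B^r_{2\infty}}E_x\|\hat x_\epsilon-x\|^2=\inf_{\tilde x_\epsilon\in\Psi}\ \sup_{x\in B^r_{2\infty}}E_x\|\tilde x_\epsilon-x\|^2\,(1+o(1))\qquad\text{as }\epsilon\to0,$$ where $\Psi$ is the set of all estimators. Moreover, the asymptotically minimax risk $R_\epsilon$ (i.e. $\inf_{\tilde x_\epsilon\in\Psi}\sup_{x\in B^r_{2\infty}}E_x\|\tilde x_\epsilon-x\|^2$, up to a factor $1+o(1)$) satisfies, as $\epsilon\to0$, $$R_\epsilon=\epsilon^2(1+o(1))\sum_{j=1}^\infty\frac{\sigma_j^2}{a_j^2+(2rP_0)^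{-1}\epsilon^2\sigma_j^2j^{2r+1}}.$$
   Context: Setting: $H$ is a separable Hilbert space with inner product $\langle\cdot,\cdot\rangle$ and norm $\|a\|=\langle a,a\rangle^{1/2}$; $A:H\to H$ is a known self-adjoint bounded linear operator with eigenvalues $\{a_i\}_{i=1}^\infty$, $a_i\neq0$, and a corresponding orthonormal basis of eigenvectors $\{\phi_i\}_{i=1}^\infty$. One wishes to estimate the solution $x\in H$ of $f=Ax$ from the observation $Y=f+\epsilon\xi$, where $\xi$ is Gaussian noise and $\epsilon>0$ is the noise level. In coordinates $x_i=\langle x,\phi_i\rangle$, $y_i=\langle Y,\phi_i\rangle$, the observation is the sequence $$y_i=a_ix_i+\epsilon\sigma_i\xi_i,\qquad 1\le i<\infty,$$ where $\sigma_i>0$ are known constants and $\xi_i$ are i.i.d. Gaussian random variables with $E[\xi_i]=0$ and $\mathrm{Var}[\xi_i]=1$. The operator, the $a_i$, the $\sigma_i$, $r$ and $P_0$ do not depend on $\epsilon$. Vectors of $H$ are identified with their coefficient sequences, so $\|x\|^2=\sum_ix_i^2$. $E_x$ denotes expectation when the true solution is $x$. The a priori set is $$B^r_{2\infty}=\Bigl\{\theta=\{\theta_i\}_{i=1}^\infty:\ \sup_{k\ge1}k^{2r}\sum_{i=k}^\infty\theta_i^2\le P_0\Bigr\}.$$ An estimator is any measurable function of the observed sequence $\{y_i\}_{i=1}^\infty$ with values in $H$ (it may depend on $\epsilon$); $\Psi$ is the set of all estimators. *)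

(* Defs.v *)
From HB Require Import structures.
From mathcomp Require Import all_boot all_order all_algebra.
From mathcomp Require Import all_classical all_reals all_analysis.
Import Order.TTheory GRing.Theory Num.Theory.
Import numFieldNormedType.Exports.

Set Implicit Arguments.
Unset Strict Implicit.
Unset Printing Implicit Defensive.

Local Open Scope classical_set_scope.
Local Open Scope ring_scope.

(* H is identified with the square-summable coefficient sequences in the
   eigenbasis of A, and A with its sequence of eigenvalues.  All sequences are
   indexed from 0: the entry of index i is the coordinate usually numbered
   i.+1, so weights such as j^(2r+1) appear as i.+1%:R `^ (2 * r + 1). *)

Definition sqnorm (R : realType) (x : nat -> R) : \bar R :=
  (\sum_(0 <= i <oo) (x i ^+ 2)%:E)%E.

Definition ell2 (R : realType) : set (nat -> R) :=
  [set x | (sqnorm x < +oo)%E].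

Definition besov_ball (R : realType) (r P0 : R) : set (nat -> R) :=
  [set theta | (ereal_sup [set (k.+1%:R `^ (2 * r))%:E *
                                \sum_(k <= i <oo) (theta i ^+ 2)%:E
                          | k in [set: nat]] <= P0%:E)%E].

(* Real sequences with the product sigma-algebra.  Since H is separable, its
   Borel sigma-algebra is the trace on ell2 of this one. *)
Definition cylinders (R : realType) : set (set (nat -> R)) :=
  \bigcup_n preimage_set_system setT (fun y : nat -> R => y n) measurable.

Definition seq_space (R : realType) := g_sigma_algebraType (@cylinders R).

Definition estimators (R : realType) : set (seq_space R -> seq_space R) :=
  [set delta : seq_space R -> seq_space R | measurable_fun setT delta /\ forall y, ell2 (delta y : nat -> R)].

Definition mutually_independent (R : realType) (d : measure_display)
    (T : measurableType d) (P : probability T R) (X : nat -> {RV P >-> R}) :=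
  forall (J : seq nat) (B : nat -> set R), uniq J ->
    (forall i, measurable (B i)) ->
    P (\big[setI/setT]_(i <- J) (X i @^-1` B i)) =
    (\prod_(i <- J) P (X i @^-1` B i))%E.

Definition iid_standard_gaussian (R : realType) (d : measure_display)
    (T : measurableType d) (P : probability T R) (xi : nat -> {RV P >-> R}) :=
  (forall i (B : set R), measurable B ->
     distribution P (xi i) B = normal_prob 0 1 B) /\
  mutually_independent xi.

Definition observation (R : realType) (d : measure_display)
    (T : measurableType d) (P : probability T R) (xi : nat -> {RV P >-> R})
    (a sigma : nat -> R) (eps : R) (x : nat -> R) (w : T) : seq_space R :=
  fun i => a i * x i + eps * sigma i * xi i w.

(* E_x || delta(y) - x ||^2 *)
Definition risk (R : realType) (d : measure_display)
    (T : measurableType d) (P : probability T R) (xi : nat -> {RV P >-> R})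
    (a sigma : nat -> R) (eps : R) (delta : seq_space R -> seq_space R)
    (x : nat -> R) : \bar R :=
  (\int[P]_w sqnorm
     (fun i => (delta (observation xi a sigma eps x w) i - x i)%R))%E.

Definition sup_risk (R : realType) (d : measure_display)
    (T : measurableType d) (P : probability T R) (xi : nat -> {RV P >-> R})
    (a sigma : nat -> R) (r P0 eps : R)
    (delta : seq_space R -> seq_space R) : \bar R :=
  ereal_sup [set risk xi a sigma eps delta x | x in besov_ball r P0].

Definition minimax_risk (R : realType) (d : measure_display)
    (T : measurableType d) (P : probability T R) (xi : nat -> {RV P >-> R})
    (a sigma : nat -> R) (r P0 eps : R) : \bar R :=
  ereal_inf [set sup_risk xi a sigma r P0 eps delta | delta in @estimators R].

(* a_j^2 + (2 r P0)^-1 eps^2 sigma_j^2 j^(2r+1) *)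
Definition tikhonov_denom (R : realType) (a sigma : nat -> R) (r P0 eps : R)
    (i : nat) : R :=
  a i ^+ 2 +
  (2 * r * P0)^-1 * eps ^+ 2 * sigma i ^+ 2 * i.+1%:R `^ (2 * r + 1).

Definition tikhonov (R : realType) (a sigma : nat -> R) (r P0 eps : R)
    (y : seq_space R) : seq_space R :=
  fun i => (a i)^-1 * (a i ^+ 2 / tikhonov_denom a sigma r P0 eps i) * y i.

(* F(eps) = G(eps) (1 + o(1)) as eps tends to 0 from above *)
Definition asymp_eq (R : realType) (F G : R -> \bar R) :=
  exists2 h : R -> R, h eps @[eps --> 0^'+] --> (0 : R) &
    \forall eps \near 0^'+, F eps = (G eps * (1 + h eps)%:E)%E.

(* Main.v *)
Require Import Defs.
From HB Require Import structures.
From mathcomp Require Import all_boot all_order all_algebra.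
From mathcomp Require Import all_classical all_reals all_analysis.
From mathcomp Require Import measurable_realfun ring lra.
Import Order.TTheory GRing.Theory Num.Theory.
Import numFieldNormedType.Exports.

Set Implicit Arguments.
Unset Strict Implicit.
Unset Printing Implicit Defensive.

Local Open Scope classical_set_scope.
Local Open Scope ring_scope.

(* With v_j = 2 r P0 j^-(2r+1), the j-th term T_j of the limiting risk is the
   Bayes risk of a N(0, v_j) prior in the j-th coordinate, and the Tikhonov rule
   is the corresponding Bayes rule.

   Upper bound: the bias coefficients increase with j by (iii), so after a
   summation by parts the worst bias over the ball is controlled by the tail sums
   of x_j^2; these are compared with those of v_j through the tangent-line
   inequality k^-2r - (k+1)^-2r <= 2r k^-(2r+1).  Only the coordinates before
   (iii) applies escape this; they contribute O(eps^4), against a risk of order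
   at least eps^2.

   Lower bound: let m be the index at which a_j^2 v_j / sigma_j^2 crosses eps^2.
   The coordinates outside [m/L, L m] carry a fraction of the risk that is small
   with 1/L.  On the remaining ones put the Gaussian prior with variances
   (1 - del) v_j; it is realised on a second copy of the noise space.  By
   Chebyshev on a fixed number of blocks it is in the ball up to probability
   O(1/m), so that discarding the exceptional event costs little once the
   estimator is truncated to a bounded norm. *)

(** * Integration against a density and affine changes of variables *)

(** The function 2 r P0 x^-(2r+1) is minus the derivative of P0 x^-2r. Hence the tail sums of
    [prior_var] nearly saturate all the constraints of the ball at once, and the same variances
    serve as prior in the lower bound and as extremal competitor in the upper bound.

    No rate of decay of [a] is assumed, so the limiting risk S cannot be evaluated. Every error is
    instead compared with S through the single estimate S >= const * m^-2r. The prior lives above q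
    n with n proportional to m, so its total variance has this same order. What is lost on the draws
    outside the ball is then, relative to S, of order 1/n plus a part made small by a splitting
    level. This fixes the order of choices: block ends and level do not depend on [eps], and [eps]
    becomes small last.

    Conditional expectations are avoided. Prior and noise are two iterated integrals over one
    probability space, independence is used one coordinate at a time, and integrands are
    nonnegative, so Tonelli applies throughout.

    The Tikhonov rule may leave H on a null set, hence is not itself an estimator; its modification
    there by zero links its risk to the infimum. *)

Section density.
Local Open Scope ereal_scope.
Context d (T : measurableType d) (R : realType).
Variables (mu nu : {measure set T -> \bar R}) (p : T -> R).
Hypotheses (p0 : forall x, (0 <= p x)%R) (mp : measurable_fun setT p).
Hypothesis nuE : forall A, measurable A -> nu A = \int[mu]_(x in A) (p x)%:E.

Import HBNNSimple.

Let mpE : measurable_fun setT (fun x => (p x)%:E).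
Proof. exact/measurable_EFinP. Qed.

Let integral_density_indic (A : set T) : measurable A ->
  \int[nu]_x (\1_A x)%:E = \int[mu]_x ((\1_A x)%:E * (p x)%:E).
Proof.
move=> mA; rewrite integral_indic//= setIT nuE// integral_mkcond/=.
apply: eq_integral => x _; rewrite patchE indicE.
by case: ifP => xA; rewrite ?mul1e ?mul0e.
Qed.

Let integral_density_nnsfun (f : {nnsfun T >-> R}) :
  \int[nu]_x (f x)%:E = \int[mu]_x ((f x)%:E * (p x)%:E).
Proof.
under [LHS]eq_integral do rewrite fimfunE -fsumEFin//.
rewrite [LHS]ge0_integral_fsum//; last 2 first.
  - by move=> r; exact/measurable_EFinP/measurableT_comp.
  - by move=> n x _; rewrite EFinM nnfun_muleindic_ge0.
under [RHS]eq_integral.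
  move=> x xD; rewrite fimfunE -fsumEFin// ge0_mule_fsuml; last first.
    by move=> r; rewrite EFinM nnfun_muleindic_ge0.
  over.
have mi (r : R) : measurable_fun setT (fun x => (r * \1_(f @^-1` [set r]) x)%:E).
  exact/measurable_EFinP/measurableT_comp.
rewrite [RHS]ge0_integral_fsum//; last 2 first.
  - by move=> r; apply: emeasurable_funM => //.
  - move=> n x _; rewrite mule_ge0 ?lee_fin//.
    by rewrite -lee_fin EFinM nnfun_muleindic_ge0.
apply: eq_fsbigr => r _.
rewrite integralZl_indic_nnsfun// integral_density_indic//.
have [r0|r0] := leP 0%R r.
  rewrite -ge0_integralZl//=.
  - by apply: eq_integral => x _; rewrite muleA EFinM.
  - apply: emeasurable_funM => //; exact/measurable_EFinP/measurable_indic.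
  - by move=> x _; rewrite mule_ge0 ?lee_fin.
rewrite preimage_nnfun0//.
under eq_integral do rewrite indic0 mul0e.
under [RHS]eq_integral do rewrite indic0 mulr0 mul0e.
by rewrite !integral0 mule0.
Qed.

Lemma ge0_integral_density (f : T -> \bar R) :
  measurable_fun setT f -> (forall x, 0 <= f x) ->
  \int[nu]_x f x = \int[mu]_x (f x * (p x)%:E).
Proof.
move=> mf f0.
pose f_ := nnsfun_approx measurableT mf.
transitivity (limn (fun n => \int[nu]_x (f_ n x)%:E)).
  rewrite -monotone_convergence//=.
  - apply: eq_integral => ? /[!inE] xD; apply/esym/cvg_lim => //=.
    exact: cvg_nnsfun_approx.
  - by move=> n; exact/measurable_EFinP/measurable_funTS.
  - by move=> n ? _; rewrite lee_fin.
  - by move=> ? _ ? ? mn; rewrite lee_fin; exact/lefP/nd_nnsfun_approx.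
under eq_fun do rewrite integral_density_nnsfun.
rewrite -monotone_convergence//=.
- apply: eq_integral => x _; apply/cvg_lim => //.
  apply: cvgeMr => //; exact: cvg_nnsfun_approx.
- by move=> n; apply: emeasurable_funM => //; exact/measurable_EFinP.
- by move=> n x _; rewrite mule_ge0 ?lee_fin.
- move=> x _ m n mn; apply: lee_wpmul2r; rewrite ?lee_fin//.
  exact/lefP/nd_nnsfun_approx.
Qed.

End density.

(** A bundled pushforward with its measurability proof as an argument, so that uniqueness and
    scaling of measures apply to it. *)
Definition image_measure d d' (T : measurableType d) (T' : measurableType d')
    (R : realType) (m : {measure set T -> \bar R}) (f : T -> T')
    (mf : measurable_fun setT f) : {measure set T' -> \bar R} :=
  measure_function_pushforward__canonical__measure_function_Measure m mf.

Section lebesgue_affine.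
Context {R : realType}.
Local Notation mu := lebesgue_measure.
Implicit Types (b s : R) (f : R -> \bar R).

Let affine b s : measurableTypeR R -> measurableTypeR R := fun u => b + s * u.

Let maffine b s : measurable_fun setT (affine b s).
Proof. by apply: measurable_funD => //; exact: measurable_funM. Qed.

(** Half-open intervals determine Lebesgue measure; on them the factor [s] undoes the division by
    [s] of the length of the preimage. *)
Let lebesgue_measure_affine b s (s0 : 0 < s) (A : set R) : measurable A ->
  mu A = mscale (NngNum (ltW s0)) (image_measure mu (maffine b s)) A.
Proof.
apply: lebesgue_measure_unique => _ [[p q]] _ <-.
have affE : affine b s @^-1` `]p, q] = `](p - b) / s, (q - b) / s]%classic.
  apply/seteqP; split => x /=; rewrite !in_itv/= /affine;
   rewrite ltr_pdivrMr// ler_pdivlMr//; lra.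
transitivity (s%:E * mu (affine b s @^-1` `]p, q]))%E; last by [].
rewrite affE.
rewrite !lebesgue_measure_itv/= !lte_fin ltr_pM2r ?invr_gt0// ltrD2r.
case: ifPn => _; last by rewrite mule0.
by rewrite -!EFinB -EFinM; congr EFin; field; rewrite gt_eqF.
Qed.

Lemma ge0_integral_affine b s f : 0 < s -> measurable_fun setT f ->
  (forall x, 0 <= f x)%E ->
  (s%:E * \int[mu]_u f (b + s * u)%R = \int[mu]_x f x)%E.
Proof.
move=> s0 mf f0.
rewrite [RHS](eq_measure_integral
   (mscale (NngNum (ltW s0)) (image_measure mu (maffine b s)))); last first.
  by move=> A mA _; exact: lebesgue_measure_affine.
rewrite ge0_integral_mscale//=; congr (_ * _)%E.
have f0' : {in setT, forall y, 0 <= f y}%E by move=> y _; exact: f0.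
exact/esym/(ge0_integral_pushforward (maffine b s) mu measurableT mf f0').
Qed.

Lemma ge0_integral_opp f : measurable_fun setT f -> (forall x, 0 <= f x)%E ->
  (\int[mu]_u f (- u)%R = \int[mu]_x f x)%E.
Proof.
move=> mf f0.
rewrite [RHS](eq_measure_integral
   (pushforward mu (-%R : _ -> measurableTypeR R))); last first.
  by move=> A mA _; exact/esym/lebesgue_measureN.
have f0' : {in setT, forall y, 0 <= f y}%E by move=> y _; exact: f0.
have mN : measurable_fun setT (-%R : measurableTypeR R -> measurableTypeR R) by [].
exact/esym/(ge0_integral_pushforward mN mu measurableT mf f0').
Qed.

End lebesgue_affine.

Section gaussian.
Context {R : realType}.
Local Notation mu := lebesgue_measure.
Local Notation N01 := (normal_prob (0 : R) 1).
Implicit Types (f : R -> \bar R).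

Lemma ge0_integral_normal_prob (m s : R) f :
  measurable_fun setT f -> (forall x, 0 <= f x)%E ->
  (\int[normal_prob m s]_x f x = \int[mu]_x (f x * (normal_pdf m s x)%:E))%E.
Proof.
move=> mf f0.
have h := @ge0_integral_density _ (measurableTypeR R) R mu (normal_prob m s) (normal_pdf m s).
apply: h => //.
- by move=> x; exact: normal_pdf_ge0.
- exact: measurable_normal_pdf.
Qed.

Lemma normal_pdf_affine (m s t x : R) : s != 0 -> 0 < t ->
  t * normal_pdf m (t * s) (m + t * x) = normal_pdf 0 s x.
Proof.
move=> s0 t0; have tn0 : t != 0 by rewrite gt_eqF.
rewrite !normal_pdfE ?mulf_neq0//= /normal_peak /normal_fun.
have -> : (t * s) ^+ 2 * pi *+ 2 = t ^+ 2 * (s ^+ 2 * pi *+ 2) by rewrite -mulrnAr -[in RHS]mulrnAr; ring.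
rewrite sqrtrM ?sqr_ge0// sqrtr_sqr gtr0_norm// invfM mulrA mulVKf//.
congr (_ * expR _).
by rewrite -(mulr_natr (s ^+ 2)) -(mulr_natr (_ ^+ 2)); field; rewrite s0.
Qed.

Lemma ge0_integral_normal_affine (m s : R) f : 0 < s ->
  measurable_fun setT f -> (forall x, 0 <= f x)%E ->
  (\int[normal_prob m s]_x f x = \int[N01]_u f (m + s * u)%R)%E.
Proof.
move=> s0 mf f0.
have maff : measurable_fun setT (fun u : R => m + s * u).
  by apply: measurable_funD => //; exact: measurable_funM.
have mfs : measurable_fun setT (fun u : R => f (m + s * u)%R).
  exact: (measurableT_comp mf maff).
have fs0 u : (0 <= f (m + s * u)%R)%E by exact: f0.
rewrite (ge0_integral_normal_prob m s mf f0) (ge0_integral_normal_prob 0 1 mfs fs0).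
have mg : measurable_fun setT (fun x => (f x * (normal_pdf m s x)%:E)%E).
  by apply: emeasurable_funM => //; apply/measurable_EFinP; exact: measurable_normal_pdf.
rewrite -(@ge0_integral_affine _ m s _ s0)//; last first.
  by move=> x; rewrite mule_ge0// lee_fin normal_pdf_ge0.
rewrite -ge0_integralZl//=.
- apply: eq_integral => x _; rewrite muleCA -EFinM.
  by rewrite -(@normal_pdf_affine m 1 s)// ?mulr1.
- exact: (measurableT_comp mg maff).
- by move=> x _; rewrite mule_ge0// lee_fin normal_pdf_ge0.
- by rewrite lee_fin ltW.
Qed.

Lemma ge0_integral_normal_opp f : measurable_fun setT f ->
  (forall x, 0 <= f x)%E ->
  (\int[N01]_u f (- u)%R = \int[N01]_u f u)%E.
Proof.
move=> mf f0.
have mfN : measurable_fun setT (fun u : R => f (- u)%R) by exact: measurableT_comp.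
have fN0 u : (0 <= f (- u)%R)%E by exact: f0.
rewrite (ge0_integral_normal_prob 0 1 mfN fN0) (ge0_integral_normal_prob 0 1 mf f0).
rewrite -[RHS]ge0_integral_opp.
- by apply: eq_integral => x _; rewrite !normal_pdfE// /normal_fun !subr0 sqrrN.
- by apply: emeasurable_funM => //; apply/measurable_EFinP; exact: measurable_normal_pdf.
- by move=> x; rewrite mule_ge0// lee_fin normal_pdf_ge0.
Qed.

End gaussian.

(** * Second and fourth moments of the standard normal law *)

Section gaussian_moments.
Context {R : realType}.
Local Notation mu := lebesgue_measure.
Local Notation N01 := (normal_prob (0 : R) 1).
Implicit Types (f : R -> \bar R).

(* Differentiating in [s] the total mass 1 of [normal_pdf 0 s] gives the second
   moment; the convexity bound [1 + z <= expR z] replaces the derivative. *)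
Lemma normal_pdf_scale (s x : R) : 0 < s ->
  normal_pdf 0 1 x * expR (x ^+ 2 / 2 * (1 - s ^- 2)) = s * normal_pdf 0 s x.
Proof.
move=> s0; have sn0 : s != 0 by rewrite gt_eqF.
rewrite !normal_pdfE//= /normal_peak /normal_fun !subr0.
have -> : s ^+ 2 * pi *+ 2 = s ^+ 2 * (1 ^+ 2 * pi *+ 2) by rewrite -mulrnAr -[in RHS]mulrnAr; ring.
rewrite [in RHS]sqrtrM ?sqr_ge0// sqrtr_sqr gtr0_norm// (invfM s (Num.sqrt _)) [RHS]mulrA [s * (_ * _)]mulrA divff// mul1r.
rewrite -[LHS]mulrA -expRD; congr (_ * expR _).
by rewrite -(mulr_natr (s ^+ 2)) -(mulr_natr (_ ^+ 2)); field; rewrite sn0.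
Qed.

(** Densities have mass one, so a pointwise comparison with a multiple of another centred Gaussian
    density bounds a moment without evaluating an integral. *)
Lemma integral_normal_le (k s : R) (g : R -> R) :
  measurable_fun setT g -> (forall x, 0 <= g x) -> 0 <= k ->
  (forall x, g x * normal_pdf 0 1 x <= k * normal_pdf 0 s x) ->
  (\int[N01]_x (g x)%:E <= k%:E)%E.
Proof.
move=> mg g0 k0 H.
rewrite ge0_integral_normal_prob//; last exact/measurable_EFinP.
apply: (@le_trans _ _ (\int[mu]_x (k%:E * (normal_pdf 0 s x)%:E))%E); last first.
  rewrite ge0_integralZl//=.
  - by rewrite integral_normal_pdf mule1.
  - by apply/measurable_EFinP; exact: measurable_normal_pdf.
  - by move=> x _; rewrite lee_fin normal_pdf_ge0.
apply: ge0_le_integral => //=.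
- by move=> x _; rewrite mule_ge0// lee_fin ?normal_pdf_ge0.
- apply: emeasurable_funM; apply/measurable_EFinP => //; exact: measurable_normal_pdf.
- apply: emeasurable_funM => //; apply/measurable_EFinP; exact: measurable_normal_pdf.
- by move=> x _; rewrite -!EFinM lee_fin.
Qed.

Let m2 := (\int[N01]_x (x ^+ 2)%:E)%E.

Let mx2 : measurable_fun setT (fun x : R => (x ^+ 2)%:E).
Proof. by apply/measurable_EFinP; exact: exprn_measurable. Qed.

Let integral_quadratic (k c : R) : 0 <= k -> 0 <= c ->
  (\int[N01]_x (k * x ^+ 2 + c)%:E = k%:E * m2 + c%:E)%E.
Proof.
move=> k0 c0.
under eq_integral do rewrite EFinD EFinM.
rewrite ge0_integralD//=.
- by rewrite ge0_integralZl_EFin// => [|x _]; rewrite ?lee_fin ?sqr_ge0// integral_cst//= probability_setT mule1.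
- by move=> x _; rewrite mule_ge0 ?lee_fin ?sqr_ge0.
- by apply: emeasurable_funM.
Qed.

(** The tilt from variance 1 to s^2 is expR (k x^2) >= 1 + k x^2; integrating gives m2 <= (s - 1) /
    k = 2 s^2 / (s + 1) <= s^2. *)
Let m2_ub (s : R) : 1 < s -> (m2 <= (s ^+ 2)%:E)%E.
Proof.
move=> s1; have s0 : 0 < s by rewrite (lt_trans _ s1).
pose k := (1 - s ^- 2) / 2.
have k0 : 0 < k by rewrite divr_gt0// subr_gt0 invf_lt1 ?exprn_gt0// exprn_egt1.
have : (\int[N01]_x (k * x ^+ 2 + 1)%:E <= s%:E)%E.
  apply: (@integral_normal_le _ s) => //.
  - by apply: measurable_funD => //; apply: measurable_funM => //; exact: exprn_measurable.
  - by move=> x; rewrite addr_ge0// mulr_ge0 ?sqr_ge0// ltW.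
  - exact: ltW.
  - move=> x; rewrite -normal_pdf_scale// mulrC ler_wpM2l ?normal_pdf_ge0//.
    rewrite addrC; apply: le_trans (expR_ge1Dx _).
    by rewrite le_eqVlt; apply/orP; left; apply/eqP; rewrite /k; field; rewrite gt_eqF.
rewrite integral_quadratic ?(ltW k0)//.
have : (0 <= m2)%E by apply: integral_ge0 => x _; rewrite lee_fin sqr_ge0.
case: m2 => [v|//|//]; last by rewrite gt0_muley ?lte_fin.
rewrite -EFinM -EFinD !lee_fin => v0 kv.
have : v <= (s - 1) / k by rewrite ler_pdivlMr// mulrC lerBrDr.
move=> /le_trans; apply.
have -> : (s - 1) / k = s ^+ 2 * (2 / (s + 1)).
  rewrite /k; field; rewrite !gt_eqF//=; last by rewrite addr_gt0.
  by rewrite subr_gt0 exprn_egt1.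
by rewrite ler_piMr ?sqr_ge0// ler_pdivrMr ?addr_gt0//; lra.
Qed.

(** For s < 1 the tilt is expR (- k x^2) >= 1 - k x^2; integrating gives 1 <= s + k m2, and (1 - s)
    / k = 2 s^2 / (s + 1) >= s^2. *)
Let m2_lb (s : R) : 0 < s -> s < 1 -> ((s ^+ 2)%:E <= m2)%E.
Proof.
move=> s0 s1.
pose k := (s ^- 2 - 1) / 2.
have k0 : 0 < k by rewrite divr_gt0// subr_gt0 invf_gt1 ?exprn_gt0// exprn_ilt1 ?ltW.

have mp : measurable_fun setT (fun x : R => (normal_pdf 0 s x)%:E).
  by apply/measurable_EFinP; exact: measurable_normal_pdf.
have mp1 : measurable_fun setT (fun x : R => (normal_pdf 0 1 x)%:E).
  by apply/measurable_EFinP; exact: measurable_normal_pdf.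
have mkx : measurable_fun setT (fun x : R => (k%:E * (x ^+ 2)%:E)%E).
  exact: emeasurable_funM.
have kx0 (x : R) : (0 <= k%:E * (x ^+ 2)%:E)%E.
  by rewrite mule_ge0// ?lee_fin ?sqr_ge0 ?ltW.
have : (1 <= s%:E + k%:E * m2)%E.
  rewrite -[X in (X <= _)%E](@integral_normal_pdf R 0 1).
  rewrite -ge0_integralZl_EFin//; last 2 first.
  - by move=> x _; rewrite lee_fin sqr_ge0.
  - exact: ltW.
  rewrite (ge0_integral_normal_prob 0 1 mkx kx0).
  have -> : s%:E = (\int[mu]_x (s%:E * (normal_pdf 0 s x)%:E))%E.
    rewrite ge0_integralZl_EFin//; last 2 first.
    - by move=> x _; rewrite lee_fin normal_pdf_ge0.
    - exact: ltW.
    by rewrite integral_normal_pdf mule1.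
  rewrite -ge0_integralD//; last 4 first.
  - by move=> x _; rewrite mule_ge0// ?lee_fin ?normal_pdf_ge0 ?ltW.
  - exact: emeasurable_funM.
  - by move=> x _; rewrite mule_ge0// ?lee_fin ?normal_pdf_ge0 ?ltW.
  - exact: emeasurable_funM.
  apply: ge0_le_integral => //.
  - by move=> x _; rewrite lee_fin normal_pdf_ge0.
  - by apply: emeasurable_funD; exact: emeasurable_funM.
  - move=> x _; rewrite -!EFinM -EFinD lee_fin -normal_pdf_scale//.
    rewrite [k * _ * _]mulrC -mulrDr ler_peMr ?normal_pdf_ge0//.
    have := expR_ge1Dx (x ^+ 2 / 2 * (1 - s ^- 2)).
    have -> : x ^+ 2 / 2 * (1 - s ^- 2) = - (k * x ^+ 2).
      by rewrite /k; field; rewrite gt_eqF.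
    lra.
case: m2 => [v||]; last by rewrite gt0_muleNy ?lte_fin.
  rewrite -EFinM -EFinD !lee_fin => kv.
  have : (1 - s) / k <= v by rewrite ler_pdivrMr// mulrC lerBlDl.
  apply: le_trans.
  have -> : (1 - s) / k = s ^+ 2 * (2 / (s + 1)).
    rewrite /k; field; rewrite !gt_eqF//=; last by rewrite addr_gt0.
    by have : s ^+ 2 < 1 by [rewrite exprn_ilt1// ltW]; lra.
  by rewrite ler_peMr ?sqr_ge0// ler_pdivlMr ?addr_gt0//; lra.
by rewrite leey.
Qed.

Lemma integral_normal_sqr : (\int[N01]_x (x ^+ 2)%:E = 1)%E.
Proof.
rewrite -/m2.
have ub (t : R) : 1 < t -> (m2 <= t%:E)%E.
  move=> t1; have t0 : 0 <= t by rewrite ltW// (lt_trans _ t1).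
  by rewrite -(sqr_sqrtr t0) m2_ub// -sqrtr1 ltr_sqrt// (lt_trans _ t1).
have lb (t : R) : 0 < t -> t < 1 -> (t%:E <= m2)%E.
  move=> t0 t1.
  by rewrite -(sqr_sqrtr (ltW t0)) m2_lb ?sqrtr_gt0// -[ltRHS]sqrtr1 ltr_sqrt.
have : (0 <= m2)%E by apply: integral_ge0 => x _; rewrite lee_fin sqr_ge0.
case: m2 ub lb => [v ub lb v0|/(_ 2)|//]; last first.
  by rewrite ltr1n => /(_ isT).
rewrite lee_fin in v0.
(* The bounds hold for every [t] on either side of 1; the midpoint of [v] and 1 refutes a strict
   inequality. *)
congr EFin; apply/eqP; rewrite eq_le; apply/andP; split; rewrite leNgt; apply/negP => v1.
  by have := ub ((1 + v) / 2); rewrite lee_fin => /(_ ltac:(lra)); lra.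
by have := lb ((1 + v) / 2); rewrite lee_fin => /(_ ltac:(lra) ltac:(lra)); lra.
Qed.

(** Any finite bound serves the later variance estimates. Doubling the standard deviation tilts by
    expR z with z = 3 x^2 / 8, and (z / 2)^2 <= expR z absorbs x^4. *)
Lemma integral_normal_pow4 : (\int[N01]_x (x ^+ 4)%:E <= 128%:E)%E.
Proof.
apply: (@integral_normal_le _ 2) => //.
- by move=> x; rewrite exprn_even_ge0.
- move=> x; have -> : 128 = 64 * 2 :> R by lra.
  rewrite -mulrA -normal_pdf_scale//.
  rewrite mulrCA mulrC ler_wpM2l ?normal_pdf_ge0//.
  set z := x ^+ 2 / 2 * _.
  have zE : z = x ^+ 2 * (3 / 8) by rewrite /z; field.
  have h : z / 2 <= expR (z / 2) by apply: le_trans (expR_ge1Dx _); rewrite lerDr.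
  have -> : z = z / 2 + z / 2 by field.
  rewrite expRD -[expR _ * _]expr2.
  have z0 : 0 <= z / 2 by rewrite zE; have := sqr_ge0 x; lra.
  have : (z / 2) ^+ 2 <= expR (z / 2) ^+ 2 by rewrite ler_pXn2r// nnegrE ?expR_ge0.
  have -> : (z / 2) ^+ 2 = x ^+ 4 * (9 / 256) by rewrite zE; field.
  have : 0 <= x ^+ 4 by rewrite exprn_even_ge0.
  lra.
Qed.

(** Averaging with the reflected variable cancels the cross term before integration, so that only
    nonnegative integrands occur. *)
Lemma integral_normal_affine_sqr (p q : R) :
  (\int[N01]_u ((p + q * u) ^+ 2)%:E = (p ^+ 2 + q ^+ 2)%:E)%E.
Proof.
have mf (q' : R) : measurable_fun setT (fun u : R => ((p + q' * u) ^+ 2)%:E).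
  apply/measurable_EFinP; apply: (measurableT_comp (exprn_measurable 2)).
  by apply: measurable_funD => //; exact: measurable_funM.
have f0 (q' : R) u : (0 <= ((p + q' * u) ^+ 2)%:E)%E by rewrite lee_fin sqr_ge0.
have h : (\int[N01]_u ((p + q * u) ^+ 2)%:E +
          \int[N01]_u ((p + q * u) ^+ 2)%:E = 2%:E * (p ^+ 2 + q ^+ 2)%:E)%E.
  rewrite -{1}(ge0_integral_normal_opp (mf q) (f0 q)).
  have mfN : measurable_fun setT (fun u : R => ((p + q * - u) ^+ 2)%:E).
    exact: (measurableT_comp (mf q)).
  rewrite -ge0_integralD; [|exact: measurableT|by []|exact: mfN|by []|exact: mf].
  transitivity (\int[N01]_u ((2 * q ^+ 2) * u ^+ 2 + 2 * p ^+ 2)%:E)%E.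
    by apply: eq_integral => u _; rewrite -EFinD; congr EFin; ring.
  rewrite integral_quadratic; last 2 first.
  - by have := sqr_ge0 q; lra.
  - by have := sqr_ge0 p; lra.
  rewrite /m2 integral_normal_sqr mule1 -EFinD -EFinM; congr EFin; ring.
have : (0 <= \int[N01]_u ((p + q * u) ^+ 2)%:E)%E by apply: integral_ge0.
move: h; case: (X in (X + X)%E) => [v|//|//].
rewrite -EFinD -EFinM => -[h] _; congr EFin; lra.
Qed.

End gaussian_moments.

(** * The scalar Gaussian Bayes problem *)

Section bayes.
Context {R : realType}.
Local Notation mu := lebesgue_measure.
Local Notation N01 := (normal_prob (0 : R) 1).

(* Completing the square: prior times likelihood is marginal times posterior. *)
Lemma normal_pdf_posterior (al tau u y : R) : 0 < tau ->
  normal_pdf 0 1 u * normal_pdf (al * u) tau y =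
  normal_pdf 0 (Num.sqrt (al ^+ 2 + tau ^+ 2)) y *
  normal_pdf (al * y / (al ^+ 2 + tau ^+ 2))
    (tau / Num.sqrt (al ^+ 2 + tau ^+ 2)) u.
Proof.
move=> tau0; set S := al ^+ 2 + tau ^+ 2.
have S0 : 0 < S by rewrite ltr_wpDl ?sqr_ge0// exprn_gt0.
have sS0 : 0 < Num.sqrt S by rewrite sqrtr_gt0.
rewrite !normal_pdfE ?gt_eqF ?divr_gt0//= /normal_peak /normal_fun.
rewrite !expr_div_n sqr_sqrtr ?(ltW S0)// mulrACA [RHS]mulrACA -!expRD.
have Sn0 : S != 0 by rewrite gt_eqF.
have t0 : tau != 0 by rewrite gt_eqF.
have pp (a : R) : 0 < a -> 0 <= a * pi *+ 2.
  by move=> a0; rewrite mulrn_wge0// ltW// mulr_gt0// pi_gt0.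
congr (_ * expR _).
  rewrite -!invfM -!sqrtrM ?pp ?divr_gt0 ?exprn_gt0//.
  have -> : 1 ^+ 2 * pi *+ 2 * (tau ^+ 2 * pi *+ 2) =
            S * pi *+ 2 * (tau ^+ 2 / S * pi *+ 2) :> R by field.
  by [].
by rewrite /S in Sn0 *; field; rewrite ?t0 ?Sn0.
Qed.

Let measurable_joint_pdf (al tau : R) : 0 < tau ->
  measurable_fun setT (fun z : R * R => normal_pdf (al * z.1) tau z.2).
Proof.
move=> tau0.
rewrite (_ : (fun _ => _) = (fun z : R * R => normal_peak tau *
   expR (- (z.2 - al * z.1) ^+ 2 / (tau ^+ 2 *+ 2)))); last first.
  by apply/funext => z; rewrite normal_pdfE ?gt_eqF.
apply: measurable_funM => //; apply: (measurableT_comp (@measurable_expR R)).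
apply: measurable_funM => //; apply: measurableT_comp => //.
apply: (measurableT_comp (exprn_measurable 2)).
by apply: measurable_funB => //; exact: measurable_funM.
Qed.

(** Given the observation y, the target [s * u'] is Gaussian with a variance that does not depend on
    y, and no guess [h y] has a smaller conditional mean square error. Scaling a standard variable
    by [s] lets [s] vanish, as it does outside the block that carries the prior. *)
Lemma gaussian_bayes_risk (h : R -> R) (al tau s : R) :
  0 < tau -> measurable_fun setT h ->
  ((s ^+ 2 * tau ^+ 2 / (al ^+ 2 + tau ^+ 2))%:E <=
   \int[N01]_u' \int[N01]_u ((h (al * u' + tau * u) - s * u') ^+ 2)%:E)%E.
Proof.
move=> tau0 mh.
set S := al ^+ 2 + tau ^+ 2.
have S0 : 0 < S by rewrite ltr_wpDl ?sqr_ge0// exprn_gt0.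
have sS0 : 0 < Num.sqrt S by rewrite sqrtr_gt0.
pose loss u y : R := (h y - s * u) ^+ 2.
have mloss : measurable_fun setT (fun z : R * R => loss z.1 z.2).
  apply: (measurableT_comp (exprn_measurable 2)).
  apply: measurable_funB => //; last exact: measurable_funM.
  exact: measurableT_comp.
have l0 u y : 0 <= loss u y by exact: sqr_ge0.
have mloss1 u : measurable_fun setT (fun y => (loss u y)%:E).
  apply/measurable_EFinP; apply: (measurableT_comp (exprn_measurable 2)).
  exact: measurable_funB.
have mloss2 y : measurable_fun setT (fun u => (loss u y)%:E).
  apply/measurable_EFinP; apply: (measurableT_comp (exprn_measurable 2)).
  by apply: measurable_funB => //; exact: measurable_funM.
pose J u y := (loss u y * (normal_pdf 0 1 u * normal_pdf (al * u) tau y))%:E.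
have J0 u y : (0 <= J u y)%E by rewrite lee_fin; apply: mulr_ge0 => //; rewrite mulr_ge0 ?normal_pdf_ge0.
have mJ : measurable_fun setT (fun z : R * R => J z.1 z.2).
  apply/measurable_EFinP; apply: measurable_funM => //.
  apply: measurable_funM; last exact: measurable_joint_pdf.
  by apply: measurableT_comp => //; exact: measurable_normal_pdf.
pose K u y := (loss u y * normal_pdf (al * u) tau y)%:E.
have K0 u y : (0 <= K u y)%E by rewrite lee_fin; apply: mulr_ge0; rewrite ?normal_pdf_ge0.
have mK : measurable_fun setT (fun z : R * R => K z.1 z.2).
  by apply/measurable_EFinP; apply: measurable_funM => //; exact: measurable_joint_pdf.
have l0E u y : (0 <= (loss u y)%:E)%E by rewrite lee_fin.
have inner1 u' : (\int[N01]_u ((h (al * u' + tau * u) - s * u') ^+ 2)%:E =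
    \int[mu]_y K u' y)%E.
  rewrite -(ge0_integral_normal_affine (al * u') tau0 (mloss1 u') (l0E u')).
  rewrite (ge0_integral_normal_prob _ _ (mloss1 u') (l0E u')).
  by apply: eq_integral => y _; rewrite -EFinM.
have mKF : measurable_fun setT (fun u' => \int[mu]_y K u' y)%E.
  exact: (measurable_fun_fubini_tonelli_F (m2 := mu) (fun z : R * R => K z.1 z.2)).
have KF0 u' : (0 <= \int[mu]_y K u' y)%E by apply: integral_ge0.
under eq_integral do rewrite inner1.
rewrite (ge0_integral_normal_prob 0 1 mKF KF0).
have inner2 u' : (\int[mu]_y K u' y * (normal_pdf 0 1 u')%:E = \int[mu]_y J u' y)%E.
  rewrite -ge0_integralZr//.
  - by apply: eq_integral => y _; rewrite /K /J -EFinM -mulrA; congr (_ * _)%:E; exact: mulrC.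
  - exact: (measurableT_comp mK (pair1_measurable u')).
  - by rewrite lee_fin normal_pdf_ge0.
under eq_integral do rewrite inner2.
rewrite (@fubini_tonelli _ _ _ _ R mu mu (fun z : R * R => J z.1 z.2) mJ (fun z => J0 z.1 z.2)).
(* For fixed y, the posterior factorisation releases the marginal density; what remains is a squared
   bias plus the posterior variance, and only the variance is kept. *)
have inner3 y : (((s ^+ 2 * tau ^+ 2 / S) * normal_pdf 0 (Num.sqrt S) y)%:E <= \int[mu]_u J u y)%E.
  set m := al * y / S; set rho := tau / Num.sqrt S.
  have rho0 : 0 < rho by rewrite divr_gt0.
  have -> : (\int[mu]_u J u y = (normal_pdf 0 (Num.sqrt S) y)%:E *
       \int[mu]_u ((loss u y)%:E * (normal_pdf m rho u)%:E))%E.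
    rewrite -ge0_integralZl//.
    - apply: eq_integral => u _; rewrite /J normal_pdf_posterior// -!EFinM.
      by rewrite mulrCA.
    - apply: emeasurable_funM; first exact: mloss2.
      by apply/measurable_EFinP; exact: measurable_normal_pdf.
    - by move=> u _; rewrite -EFinM lee_fin; apply: mulr_ge0; rewrite ?normal_pdf_ge0.
    - by rewrite lee_fin normal_pdf_ge0.
  rewrite mulrC EFinM lee_wpmul2l// ?lee_fin ?normal_pdf_ge0//.
  rewrite -(ge0_integral_normal_prob _ _ (mloss2 y) (fun u => l0E u y)).
  rewrite (ge0_integral_normal_affine m rho0 (mloss2 y) (fun u => l0E u y)).
  under eq_integral => u _.
    rewrite /loss (_ : h y - s * (m + rho * u) = (h y - s * m) + (- (s * rho)) * u); last by ring.
    over.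
  rewrite integral_normal_affine_sqr lee_fin.
  rewrite (_ : (- (s * rho)) ^+ 2 = s ^+ 2 * tau ^+ 2 / S).
    by rewrite lerDr sqr_ge0.
  by rewrite sqrrN exprMn expr_div_n sqr_sqrtr ?(ltW S0)// mulrA.
apply: (@le_trans _ _ (\int[mu]_y ((s ^+ 2 * tau ^+ 2 / S) * normal_pdf 0 (Num.sqrt S) y)%:E)%E).
  under eq_integral do rewrite EFinM.
  have c0 : 0 <= s ^+ 2 * tau ^+ 2 / S by rewrite divr_ge0 ?(ltW S0)// mulr_ge0// sqr_ge0.
  rewrite ge0_integralZl_EFin//.
  - by rewrite integral_normal_pdf mule1.
  - by move=> y _; rewrite lee_fin normal_pdf_ge0.
  - by apply/measurable_EFinP; exact: measurable_normal_pdf.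
apply: ge0_le_integral => //.
- move=> y _; rewrite lee_fin mulr_ge0// ?normal_pdf_ge0//.
  by rewrite divr_ge0 ?(ltW S0)// mulr_ge0// sqr_ge0.
- apply/measurable_EFinP; apply: measurable_funM => //; exact: measurable_normal_pdf.
- exact: (measurable_fun_fubini_tonelli_G (m1 := mu) (fun z : R * R => J z.1 z.2)).
Qed.

End bayes.

(** * The Gaussian sequence space *)

Section seq_space_measurability.
Context {R : realType}.

Lemma measurable_coord (n : nat) : measurable_fun setT (fun y : seq_space R => y n).
Proof.
move=> _ B mB; rewrite setTI; apply: sub_sigma_algebra.
by exists n => //; exists B => //; rewrite setTI.
Qed.

Lemma measurable_fun_seq d (T : measurableType d) (f : T -> seq_space R) :
  (forall n, measurable_fun setT (fun t => f t n)) -> measurable_fun setT f.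
Proof.
move=> mf; apply: (@measurability _ _ T (seq_space R) setT f (@cylinders R) erefl).
move=> _ [_ [n _ [B mB <-]] <-].
by rewrite !setTI -(setTI (_ @^-1` _)); exact: (mf n).
Qed.

Definition upd (i : nat) (z : seq_space R) (u : R) : seq_space R :=
  fun k => if k == i then u else z k.

Lemma measurable_upd d (T : measurableType d) (i : nat) (f : T -> seq_space R)
    (g : T -> R) : measurable_fun setT f -> measurable_fun setT g ->
  measurable_fun setT (fun t => upd i (f t) (g t)).
Proof.
move=> mf mg; apply: measurable_fun_seq => n; rewrite /upd.
by case: eqP => // _; exact: (measurableT_comp (measurable_coord n)).
Qed.

Definition box (n : nat) (B : nat -> set R) : set (seq_space R) :=
  [set y | forall k, (k < n)%N -> B k (y k)].

(* The [cylinders] restrict a single coordinate and are not stable under intersection. *)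
Definition boxes : set (set (seq_space R)) :=
  [set A | exists n B, (forall k, measurable (B k)) /\ A = box n B].

Lemma boxE n B : box n B = \big[setI/setT]_(k <- iota 0 n) (fun y : seq_space R => y k) @^-1` B k.
Proof.
apply/seteqP; split => y.
  move=> By; rewrite -bigcap_seq => k /=; rewrite mem_iota add0n => /andP[_ kn].
  exact: By.
by rewrite -bigcap_seq => By k kn; apply: By; rewrite /= mem_iota.
Qed.

Lemma measurable_box n B : (forall k, measurable (B k)) -> measurable (box n B).
Proof.
move=> mB; rewrite boxE; apply: bigsetI_measurable => k _.
by rewrite -(setTI (_ @^-1` _)); exact: measurable_coord.
Qed.

Lemma box_widen n m B : (n <= m)%N ->
  box n B = box m (fun k => if (k < n)%N then B k else setT).
Proof.
move=> nm; apply/seteqP; split => y By k.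
  by move=> km; case: ifPn => // kn; exact: By.
by move=> kn; have := By k (leq_trans kn nm); rewrite kn.
Qed.

Lemma measurable_seq_boxes :
  @measurable _ (seq_space R) = <<s boxes >>.
Proof.
apply/seteqP; split.
  apply: smallest_sub; first exact: smallest_sigma_algebra.
  move=> _ [n _ [B mB <-]]; rewrite setTI; apply: sub_sigma_algebra.
  exists n.+1, (fun k => if k == n then B else setT); split.
    by move=> k; case: ifP.
  apply/seteqP; split => y /= By.
    by move=> k _; case: eqP => // ->.
  by have := By n (ltnSn n); rewrite eqxx.
apply: smallest_sub; first exact: sigma_algebra_measurable.
by move=> _ [n [B [mB ->]]]; exact: measurable_box.
Qed.

Lemma setI_closed_boxes : setI_closed boxes.
Proof.
move=> _ _ [n [B [mB ->]]] [m [C [mC ->]]].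
rewrite (box_widen B (leq_maxl n m)) (box_widen C (leq_maxr n m)).
exists (maxn n m), (fun k => (if (k < n)%N then B k else setT) `&` (if (k < m)%N then C k else setT)).
split; first by move=> k; apply: measurableI; case: ifP.
apply/seteqP; split => y.
  by move=> [By Cy] k km; split; [exact: By|exact: Cy].
by move=> BCy; split => k km; have [] := BCy k km.
Qed.

Lemma seq_measure_unique (m1 m2 : {measure set (seq_space R) -> \bar R}) :
  (m1 setT < +oo)%E ->
  (forall n B, (forall k, measurable (B k)) -> m1 (box n B) = m2 (box n B)) ->
  forall A, measurable A -> m1 A = m2 A.
Proof.
move=> m1oo m12; apply: (measure_unique boxes (fun=> setT)).
- exact: measurable_seq_boxes.
- exact: setI_closed_boxes.
(* The box of length 0 is the whole space, so a constant sequence exhausts it. *)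
- move=> _; exists 0%N, (fun=> setT); split => //.
  by apply/seteqP; split => // y _ k.
- by apply/seteqP; split => // y _; exists 0%N.
- by move=> _ [n [B [mB ->]]]; exact: m12.
- by [].
Qed.

End seq_space_measurability.

Section gaussian_sequence.
Local Open Scope ereal_scope.
Context {R : realType} {d : measure_display} {T : measurableType d}.
Context (P : probability T R) (xi : nat -> {RV P >-> R}).
Hypothesis xi_iid : iid_standard_gaussian xi.
Local Notation N01 := (normal_prob (0 : R) 1).

Definition noise (w : T) : seq_space R := fun i => xi i w.

Lemma measurable_noise : measurable_fun setT noise.
Proof. by apply: measurable_fun_seq => n; rewrite /noise; exact: measurable_funP. Qed.

Lemma noise_marginal (i : nat) (f : R -> \bar R) :
  measurable_fun setT f -> (forall x, 0 <= f x) ->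
  \int[P]_w f (noise w i) = \int[N01]_x f x.
Proof.
move=> mf f0.
have h := ge0_integral_distribution (xi i) mf f0.
rewrite /noise -[LHS]h.
(* The identity moves [normal_prob] from [measurableTypeR R] to the copy of the Borel line on which
   the law of [xi i] lives. *)
have mid : measurable_fun setT (idfun : measurableTypeR R -> R).
  by move=> _ A mA; rewrite setTI.
have f0' : {in setT, forall y, 0 <= f y} by move=> y _; exact: f0.
have h' := ge0_integral_pushforward mid N01 measurableT mf f0'.
rewrite preimage_setT in h'.
transitivity (\int[pushforward N01 (idfun : measurableTypeR R -> R)]_y f y); last exact: h'.
by apply: eq_measure_integral => A mA _; exact: xi_iid.1.
Qed.

Lemma noise_box n B : (forall k, measurable (B k)) ->
  P (noise @^-1` box n B) = \prod_(k <- iota 0 n) N01 (B k).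
Proof.
move=> mB.
have -> : noise @^-1` box n B = \big[setI/setT]_(k <- iota 0 n) (xi k @^-1` B k).
  apply/seteqP; split => w.
    move=> By; rewrite -bigcap_seq => k /=; rewrite mem_iota add0n => /andP[_ kn].
    exact: By.
  by rewrite -bigcap_seq => By k kn; apply: By; rewrite /= mem_iota.
rewrite (proj2 xi_iid) ?iota_uniq//.
by apply: eq_bigr => k _; exact: (proj1 xi_iid).
Qed.

Let resample (i : nat) (z : T * measurableTypeR R) : seq_space R := upd i (noise z.1) z.2.

Let mresample i : measurable_fun setT (resample i).
Proof.
apply: measurable_upd; last exact: measurable_snd.
by apply: measurableT_comp; [exact: measurable_noise|exact: measurable_fst].
Qed.

(** On a box both sides are the same product of one-dimensional masses; the factor of index [i] is
    merely carried by the fresh variable. *)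
Let resample_law i (A : set (seq_space R)) : measurable A ->
  image_measure P measurable_noise A = image_measure (P \x N01) (mresample i) A.
Proof.
apply: seq_measure_unique.
  by rewrite /image_measure/= /pushforward preimage_setT probability_setT ltry.
move=> n B mB.
(* The box is widened, trivially if need be, so that it does constrain coordinate [i]. *)
rewrite (box_widen B (leq_maxl n i.+1)).
set m := maxn n i.+1; set C : nat -> set R := fun k => if (k < n)%N then _ else _.
have im : (i < m)%N by rewrite leq_maxr.
have mC k : measurable (C k) by rewrite /C; case: ifP.
rewrite /image_measure/= /pushforward.
pose C' k := if k == i then setT else C k.
have mC' k : measurable (C' k) by rewrite /C'; case: ifP.
have -> : resample i @^-1` box m C = (noise @^-1` box m C') `*` C i.
  apply/seteqP; split => -[w u].
    move=> /= By; split => /=.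
      move=> k km; rewrite /C'; have := By k km; rewrite /resample/= /upd.
      by case: eqP.
    by have := By i im; rewrite /resample/= /upd eqxx.
  move=> /= [By Cu] k km; rewrite /resample/= /upd; case: eqP => [->//|ki].
  by have := By k km; rewrite /C'; case: eqP.
have mbox : measurable (noise @^-1` box m C').
  rewrite -[X in measurable X]setTI; apply: measurable_noise => //.
  exact: measurable_box.
rewrite (noise_box m mC).
transitivity (\prod_(k <- iota 0 m) N01 (C' k) * N01 (C i)); last first.
  rewrite -(noise_box m mC'); apply/esym.
  exact: (@product_measure1E _ _ T (measurableTypeR R) R P N01 _ (C i) mbox (mC i)).
have iin : i \in iota 0 m by rewrite mem_iota.
rewrite (bigD1_seq i)//= ?iota_uniq// [in RHS](bigD1_seq i)//= ?iota_uniq//.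
have -> : C' i = setT by rewrite /C' eqxx.
rewrite probability_setT mul1e muleC; congr (_ * _).
by apply: eq_bigr => k /negbTE ki; rewrite /C' ki.
Qed.

(* How independence is used: a coordinate can be integrated out separately. *)
Lemma noise_resample (i : nat) (F : seq_space R -> \bar R) :
  measurable_fun setT F -> (forall z, 0 <= F z) ->
  \int[P]_w F (noise w) = \int[P]_w \int[N01]_u F (upd i (noise w) u).
Proof.
move=> mF F0.
have F0' : {in setT, forall y, 0 <= F y} by move=> y _; exact: F0.
have h1 := ge0_integral_pushforward measurable_noise P measurableT mF F0'.
rewrite preimage_setT in h1.
have h2 := ge0_integral_pushforward (mresample i) (P \x N01) measurableT mF F0'.
rewrite preimage_setT in h2.
rewrite -[LHS]h1.
transitivity (\int[pushforward (P \x N01) (resample i)]_y F y).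
  apply: (@eq_measure_integral _ _ R setT (image_measure (P \x N01) (mresample i)) (image_measure P measurable_noise)) => A mA _.
  exact: (resample_law i mA).
rewrite h2 fubini_tonelli1//.
- exact: measurableT_comp.
- by move=> z; exact: F0.
Qed.

End gaussian_sequence.

Section integral_mono.
Local Open Scope ereal_scope.
Context d (T : measurableType d) (R : realType) (mu : {measure set T -> \bar R}).

(** Measurability plays no part because the nonnegative integral is a supremum over simple functions
    below the integrand. This allows comparing iterated integrals and risks directly. *)
Lemma ge0_le_integralT (f g : T -> \bar R) :
  (forall x, 0 <= f x) -> (forall x, f x <= g x) ->
  \int[mu]_x f x <= \int[mu]_x g x.
Proof.
move=> f0 fg; rewrite !ge0_integralTE//; last first.
  by move=> x; exact: le_trans (fg x).
by apply: ereal_sup_le => _ [h hf <-]; exists h => // x; exact: le_trans (fg x).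
Qed.

End integral_mono.

Section bayes_sequence.
Local Open Scope ereal_scope.
Context {R : realType} {d : measure_display} {T : measurableType d}.
Context (P : probability T R) (xi : nat -> {RV P >-> R}).
Hypothesis xi_iid : iid_standard_gaussian xi.
Local Notation N01 := (normal_prob (0 : R) 1).
Local Notation noise := (noise xi).

(** The observation when the true solution is the prior draw with coordinates [s k * z' k]; [z'] and
    [z] will be two separately integrated copies of the noise. *)
Definition obs_map (a s tau : nat -> R) (z' z : seq_space R) : seq_space R :=
  fun k => (a k * (s k * z' k) + tau k * z k)%R.

Lemma measurable_obs_map a s tau d' (T' : measurableType d') (f g : T' -> seq_space R) :
  measurable_fun setT f -> measurable_fun setT g ->
  measurable_fun setT (fun t => obs_map a s tau (f t) (g t)).
Proof.
move=> mf mg; apply: measurable_fun_seq => n; apply: measurable_funD.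
  by do 2 apply: measurable_funM => //; exact: (measurableT_comp (measurable_coord n)).
by apply: measurable_funM => //; exact: (measurableT_comp (measurable_coord n)).
Qed.

Lemma obs_map_upd a s tau i z' z u' u :
  obs_map a s tau (upd i z' u') (upd i z u) =
  upd i (obs_map a s tau z' z) (a i * (s i * u') + tau i * u).
Proof.
by apply/funext => k; rewrite /obs_map /upd; case: eqP => // ->.
Qed.

(** The guess [h] may look at all coordinates. Resampling coordinate [i] in both copies and freezing
    the others leaves a scalar problem for a guess depending on one real observation. *)
Lemma bayes_coord (a s tau : nat -> R) (i : nat) (h : seq_space R -> R) :
  (0 < tau i)%R -> measurable_fun setT h ->
  (s i ^+ 2 * tau i ^+ 2 / (a i ^+ 2 * s i ^+ 2 + tau i ^+ 2))%:E <=
  \int[P]_w' \int[P]_w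
    ((h (obs_map a s tau (noise w') (noise w)) - s i * noise w' i) ^+ 2)%:E.
Proof.
move=> tau0 mh; set c := (_ / _)%R.
pose H (z' z : seq_space R) := ((h (obs_map a s tau z' z) - s i * z' i) ^+ 2)%:E.
have H0 z' z : 0 <= H z' z by rewrite lee_fin sqr_ge0.
have mH d' (T' : measurableType d') (f g : T' -> seq_space R) :
    measurable_fun setT f -> measurable_fun setT g ->
    measurable_fun setT (fun t => H (f t) (g t)).
  move=> mf mg; apply/measurable_EFinP; apply: (measurableT_comp (exprn_measurable 2)).
  apply: measurable_funB.
    by apply: (measurableT_comp mh); exact: measurable_obs_map.
  by apply: measurable_funM => //; exact: (measurableT_comp (measurable_coord i)).
have mnoise := measurable_noise xi.
have step1 w' : \int[P]_w H (noise w') (noise w) =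
    \int[P]_w \int[N01]_u H (noise w') (upd i (noise w) u).
  by apply: (noise_resample xi_iid i (F := H (noise w'))) => //; exact: mH.
under eq_integral do rewrite -/(H _ _) step1.
pose G (z' : seq_space R) w := \int[N01]_u H z' (upd i (noise w) u).
have G0 z' w : 0 <= G z' w by apply: integral_ge0.
have mG d' (T' : measurableType d') (f : T' -> seq_space R) (g : T' -> T) :
    measurable_fun setT f -> measurable_fun setT g ->
    measurable_fun setT (fun t => G (f t) (g t)).
  move=> mf mg.
  apply: (measurable_fun_fubini_tonelli_F (m2 := N01)
    (fun z : T' * measurableTypeR R => H (f z.1) (upd i (noise (g z.1)) z.2))) => //.
  apply: mH; first exact: measurableT_comp.
  apply: measurable_upd => //.
  by apply: measurableT_comp => //; exact: measurableT_comp.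
have mF : measurable_fun setT (fun z' : seq_space R => \int[P]_w G z' w).
  apply: (measurable_fun_fubini_tonelli_F (m2 := P)
    (fun z : seq_space R * T => G z.1 z.2)) => //.
  exact: mG.
have F0 (z' : seq_space R) : 0 <= \int[P]_w G z' w by apply: integral_ge0.
have step2 : \int[P]_w' \int[P]_w G (noise w') w =
    \int[P]_w' \int[N01]_u' \int[P]_w G (upd i (noise w') u') w.
  exact: (noise_resample xi_iid i mF).
rewrite [leRHS]step2.
(* The integral over [u'] has to pass inside the one over [w] to stand next to the integral over [u]
   hidden in [G]. *)
have step3 w' : \int[N01]_u' \int[P]_w G (upd i (noise w') u') w =
    \int[P]_w \int[N01]_u' G (upd i (noise w') u') w.
  apply: (fubini_tonelli (m1 := N01) (m2 := P)
    (fun z : measurableTypeR R * T => G (upd i (noise w') z.1) z.2)) => //.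
  by apply: mG => //; exact: measurable_upd.
under eq_integral do rewrite step3.
have c0 : (0 <= c)%R.
  by rewrite /c -!exprMn divr_ge0 ?sqr_ge0// addr_ge0 ?sqr_ge0.
have key w' w : c%:E <= \int[N01]_u' G (upd i (noise w') u') w.
  have -> : c = (s i ^+ 2 * tau i ^+ 2 / ((a i * s i) ^+ 2 + tau i ^+ 2))%R.
    by rewrite exprMn.
  pose h' t := h (upd i (obs_map a s tau (noise w') (noise w)) t).
  have mh' : measurable_fun setT h'.
    by apply: (measurableT_comp mh); exact: measurable_upd.
  have := gaussian_bayes_risk (a i * s i) (s i) tau0 mh'.
  congr (_ <= _); apply: eq_integral => u' _; apply: eq_integral => u _.
  by rewrite /H obs_map_upd /h' mulrA /upd eqxx.
have P1 : \int[P]_w c%:E = c%:E by rewrite integral_cst//= probability_setT mule1.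
rewrite -P1; apply: ge0_le_integralT => [w'|w']; first by rewrite lee_fin.
by rewrite -P1; apply: ge0_le_integralT => w; rewrite ?lee_fin.
Qed.

End bayes_sequence.

(** * Moments and deviations of weighted sums of squared Gaussians *)

Section noise_moments.
Local Open Scope ereal_scope.
Context {R : realType} {d : measure_display} {T : measurableType d}.
Context (P : probability T R) (xi : nat -> {RV P >-> R}).
Hypothesis xi_iid : iid_standard_gaussian xi.
Local Notation N01 := (normal_prob (0 : R) 1).
Local Notation noise := (noise xi).

Lemma measurable_noise_coord k : measurable_fun setT (fun w => noise w k).
Proof. exact: (measurableT_comp (measurable_coord k) (measurable_noise xi)). Qed.

Lemma noise_sqr k : \int[P]_w (noise w k ^+ 2)%:E = 1.
Proof.
have m2 : measurable_fun setT (fun x : R => (x ^+ 2)%:E).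
  by apply/measurable_EFinP; exact: exprn_measurable.
rewrite (noise_marginal xi_iid k m2); first exact: integral_normal_sqr.
by move=> x; rewrite lee_fin sqr_ge0.
Qed.

Lemma noise_pow4 k : \int[P]_w (noise w k ^+ 4)%:E <= 128%:E.
Proof.
have m4 : measurable_fun setT (fun x : R => (x ^+ 4)%:E).
  by apply/measurable_EFinP; exact: exprn_measurable.
rewrite (noise_marginal xi_iid k m4); first exact: integral_normal_pow4.
by move=> x; rewrite lee_fin exprn_even_ge0.
Qed.

Lemma noise_sqr_sqr i j : i != j ->
  \int[P]_w (noise w i ^+ 2 * noise w j ^+ 2)%:E = 1.
Proof.
move=> ij.
pose F (z : seq_space R) := (z i ^+ 2 * z j ^+ 2)%:E.
have mF : measurable_fun setT F.
  apply/measurable_EFinP; apply: measurable_funM;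
    by apply: (measurableT_comp (exprn_measurable 2)); exact: measurable_coord.
have F0 z : 0 <= F z by rewrite lee_fin mulr_ge0// sqr_ge0.
rewrite (noise_resample xi_iid i mF F0) -[RHS](noise_sqr j).
apply: eq_integral => w _.
under eq_integral => u _ do rewrite /F /upd eqxx eq_sym (negbTE ij) mulrC EFinM.
rewrite ge0_integralZl_EFin ?sqr_ge0//.
- by rewrite integral_normal_sqr mule1.
- by move=> x _; rewrite lee_fin sqr_ge0.
- by apply/measurable_EFinP; exact: exprn_measurable.
Qed.

Section quadratic_form.
Variables (c : nat -> R) (N : nat).
Hypothesis c0 : forall k, (0 <= c k)%R.

Definition quad_form (w : T) : R := (\sum_(0 <= k < N) c k * noise w k ^+ 2)%R.

Lemma quad_form_ge0 w : (0 <= quad_form w)%R.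
Proof. by apply: sumr_ge0 => k _; rewrite mulr_ge0 ?sqr_ge0. Qed.

Lemma measurable_quad_form : measurable_fun setT quad_form.
Proof.
apply: measurable_sum => k; apply: measurable_funM => //.
by apply: (measurableT_comp (exprn_measurable 2)); exact: measurable_noise_coord.
Qed.

Let mean := (\sum_(0 <= k < N) c k)%R.

Let mean0 : (0 <= mean)%R. Proof. exact: sumr_ge0. Qed.

Lemma quad_form_mean : \int[P]_w (quad_form w)%:E = (\sum_(0 <= k < N) c k)%:E.
Proof.
under eq_integral do rewrite /quad_form -sumEFin.
have m k : measurable_fun setT (fun w => (noise w k ^+ 2)%:E).
  apply/measurable_EFinP; apply: (measurableT_comp (exprn_measurable 2)).
  exact: measurable_noise_coord.
rewrite ge0_integral_sum//; last 2 first.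
- by move=> k; under eq_fun do rewrite EFinM; exact: emeasurable_funM.
- by move=> k w _; rewrite lee_fin mulr_ge0// sqr_ge0.
rewrite -sumEFin; apply: eq_bigr => k _.
under eq_integral do rewrite EFinM.
by rewrite ge0_integralZl_EFin ?noise_sqr ?mule1// => w _; rewrite lee_fin sqr_ge0.
Qed.

(** By independence an off-diagonal product has expectation exactly c_i c_j; a diagonal one is
    bounded through the fourth moment, the source of the 128. *)
Lemma quad_form_moment2 : \int[P]_w (quad_form w ^+ 2)%:E <=
  ((\sum_(0 <= k < N) c k) ^+ 2 + 128 * \sum_(0 <= k < N) c k ^+ 2)%:E.
Proof.
have m2 k : measurable_fun setT (fun w => (noise w k ^+ 2)%R).
  apply: (measurableT_comp (exprn_measurable 2)).
  exact: measurable_noise_coord.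
pose q i j w := (c i * c j * (noise w i ^+ 2 * noise w j ^+ 2))%:E.
have q0 i j w : 0 <= q i j w.
  by rewrite lee_fin; apply: mulr_ge0; [exact: mulr_ge0|rewrite mulr_ge0// sqr_ge0].
have mq i j : measurable_fun setT (q i j).
  by apply/measurable_EFinP; apply: measurable_funM => //; exact: measurable_funM.
have -> : \int[P]_w (quad_form w ^+ 2)%:E =
    \sum_(0 <= i < N) \sum_(0 <= j < N) \int[P]_w q i j w.
  transitivity (\int[P]_w \sum_(0 <= i < N) \sum_(0 <= j < N) q i j w).
    apply: eq_integral => w _; rewrite expr2 /quad_form big_distrlr/= -sumEFin.
    apply: eq_bigr => i _; rewrite -sumEFin; apply: eq_bigr => j _.
    by rewrite /q; congr (_%:E); rewrite mulrACA.
  rewrite ge0_integral_sum//; last 2 first.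
  - by move=> i; exact: emeasurable_sum.
  - by move=> i w _; apply: sume_ge0.
  by apply: eq_bigr => i _; rewrite ge0_integral_sum.
have qle i j : \int[P]_w q i j w <= (c i * c j + (if i == j then 128 * c i ^+ 2 else 0))%:E.
  rewrite /q; under eq_integral do rewrite EFinM.
  rewrite ge0_integralZl_EFin; first last.
  - exact: mulr_ge0.
  - by apply/measurable_EFinP; exact: measurable_funM.
  - by move=> w _; rewrite lee_fin mulr_ge0// sqr_ge0.
  - exact: measurableT.
  case: eqVneq => [<-|ij]; last by rewrite noise_sqr_sqr// mule1 addr0.
  under eq_integral do rewrite -exprD.
  apply: (@le_trans _ _ ((c i * c i)%:E * 128%:E)).
    by rewrite lee_wpmul2l// ?lee_fin ?mulr_ge0//; exact: noise_pow4.
  by rewrite -EFinM lee_fin expr2 [leLHS]mulrC lerDr mulr_ge0.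
apply: (@le_trans _ _ (\sum_(0 <= i < N) \sum_(0 <= j < N)
    (c i * c j + (if i == j then 128 * c i ^+ 2 else 0))%:E)).
  by apply: lee_sum => i _; apply: lee_sum => j _; exact: qle.
under eq_bigr do rewrite sumEFin big_split/= -big_distrr/=.
rewrite sumEFin big_split/= -big_distrl/= -expr2 lee_fin lerD2l mulr_sumr.
rewrite [leLHS]big_nat_cond [leRHS]big_nat_cond.
apply: ler_sum => i; rewrite andbT => /andP[_ iN].
rewrite (bigD1_seq i)/= ?iota_uniq ?mem_index_iota// eqxx big1 ?addr0//.
by move=> j /negbTE; rewrite eq_sym => ->.
Qed.

Lemma quad_form_deviation t : (0 < t)%R ->
  P [set w | (\sum_(0 <= k < N) c k + t <= quad_form w)%R] <=
  (128 * (\sum_(0 <= k < N) c k ^+ 2) / t ^+ 2)%:E.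
Proof.
move=> t0; set V := (\sum_(0 <= k < N) c k ^+ 2)%R.
set A := [set w | _].
have mX := measurable_quad_form.
have mA : measurable A.
  rewrite -[A]setTI; exact: (measurable_fun_ler (measurable_cst _) mX).
have mX2 : measurable_fun setT (fun w => ((quad_form w - mean) ^+ 2)%:E).
  apply/measurable_EFinP; apply: (measurableT_comp (exprn_measurable 2)).
  exact: measurable_funB.
have var : \int[P]_w ((quad_form w - mean) ^+ 2)%:E <= (128 * V)%:E.
  (* The variance identity is arranged with nonnegative terms on both sides, so it holds in the
     extended reals; the finite second moment then permits subtracting. *)
  have e : \int[P]_w ((quad_form w - mean) ^+ 2)%:E + ((2 * mean) * mean)%:E =
      \int[P]_w (quad_form w ^+ 2)%:E + (mean ^+ 2)%:E.
    have -> : ((2 * mean) * mean)%:E = \int[P]_w ((2 * mean)%:E * (quad_form w)%:E).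
      rewrite ge0_integralZl_EFin ?quad_form_mean//.
      - by move=> w _; rewrite lee_fin quad_form_ge0.
      - exact/measurable_EFinP.
      - by rewrite mulr_ge0.
    have -> : (mean ^+ 2)%:E = \int[P]_w (mean ^+ 2)%:E.
      by rewrite integral_cst//= probability_setT mule1.
    rewrite -!ge0_integralD//.
    - apply: eq_integral => w _; rewrite -EFinM -!EFinD; congr (_%:E); ring.
    - by move=> w _; rewrite lee_fin sqr_ge0.
    - apply/measurable_EFinP; exact: (measurableT_comp (exprn_measurable 2)).
    - by move=> w _; rewrite lee_fin sqr_ge0.
    - by move=> w _; rewrite lee_fin sqr_ge0.
    - by move=> w _; rewrite -EFinM lee_fin !mulr_ge0// quad_form_ge0.
    - by apply: emeasurable_funM => //; exact/measurable_EFinP.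
  move: e quad_form_moment2; rewrite -/mean -/V.
  have : 0 <= \int[P]_w ((quad_form w - mean) ^+ 2)%:E.
    by apply: integral_ge0 => w _; rewrite lee_fin sqr_ge0.
  have : 0 <= \int[P]_w (quad_form w ^+ 2)%:E.
    by apply: integral_ge0 => w _; rewrite lee_fin sqr_ge0.
  move: (\int[P]_w ((quad_form w - mean) ^+ 2)%:E).
  move: (\int[P]_w (quad_form w ^+ 2)%:E) => J I.
  case: J => [j|//|//] _; case: I => [i|//|//] _.
  by rewrite -!EFinD => -[ij]; rewrite !lee_fin => jV; nra.
rewrite -[leRHS]mule1.
have -> : (128 * V / t ^+ 2)%:E * 1 = (t ^- 2)%:E * (128 * V)%:E.
  by rewrite mule1 -EFinM mulrC.
apply: (@le_trans _ _ ((t ^- 2)%:E * \int[P]_w ((quad_form w - mean) ^+ 2)%:E)); last first.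
  by rewrite lee_wpmul2l// lee_fin invr_ge0 sqr_ge0.
rewrite -ge0_integralZl_EFin//; last 2 first.
- by move=> w _; rewrite lee_fin sqr_ge0.
- by rewrite invr_ge0 sqr_ge0.
have -> : P A = \int[P]_w (\1_A w)%:E by rewrite integral_indic// setIT.
apply: ge0_le_integralT => w; first by rewrite lee_fin.
rewrite indicE; case: (boolP (w \in A)) => wA; last first.
  by rewrite -EFinM lee_fin mulr_ge0// ?invr_ge0 sqr_ge0.
move: wA; rewrite inE /A/= -/mean => wA.
rewrite -EFinM lee_fin mulrC ler_pdivlMr ?exprn_gt0// mul1r.
rewrite ler_pXn2r// ?nnegrE ?(ltW t0)//; lra.
Qed.

(** Split at the level [b]: on [A] the form is at most [b] plus its square over [b]. The level
    trades the probability of [A] against the second moment and is chosen later. *)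
Lemma integral_quad_form_on (A : set T) (b : R) : measurable A -> (0 < b)%R ->
  \int[P]_(w in A) (quad_form w)%:E <= b%:E * P A +
    (((\sum_(0 <= k < N) c k) ^+ 2 + 128 * \sum_(0 <= k < N) c k ^+ 2) / b)%:E.
Proof.
move=> mA b0.
have mX := measurable_quad_form.
have mX2 : measurable_fun setT (fun w => (quad_form w ^+ 2)%:E).
  apply/measurable_EFinP; exact: (measurableT_comp (exprn_measurable 2)).
rewrite integral_mkcond/=.
apply: (@le_trans _ _ (\int[P]_w (b%:E * (\1_A w)%:E + (b^-1)%:E * (quad_form w ^+ 2)%:E))).
  apply: ge0_le_integralT => w; rewrite patchE.
    by case: ifP => // _; rewrite lee_fin quad_form_ge0.
  rewrite indicE; case: ifP => _; last first.
    by rewrite mule0 add0e -EFinM lee_fin mulr_ge0 ?sqr_ge0// invr_ge0 ltW.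
  rewrite mule1 -EFinM -EFinD lee_fin.
  have [Xb|bX] := leP (quad_form w) b.
    by apply: (le_trans Xb); rewrite lerDl mulr_ge0 ?sqr_ge0// invr_ge0 ltW.
  apply: (@le_trans _ _ (b^-1 * quad_form w ^+ 2)%R); last by rewrite lerDr ltW.
  by rewrite mulrC ler_pdivlMr// expr2 ler_wpM2l ?quad_form_ge0// ltW.
have f10 w : setT w -> 0 <= b%:E * (\1_A w)%:E.
  by move=> _; rewrite -EFinM lee_fin mulr_ge0// ltW.
have f20 w : setT w -> 0 <= (b^-1)%:E * (quad_form w ^+ 2)%:E.
  by move=> _; rewrite -EFinM lee_fin mulr_ge0 ?sqr_ge0// invr_ge0 ltW.
have mf1 : measurable_fun setT (fun w => b%:E * (\1_A w)%:E).
  by apply: emeasurable_funM => //; apply/measurable_EFinP; exact: measurable_indic.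
have mf2 : measurable_fun setT (fun w => (b^-1)%:E * (quad_form w ^+ 2)%:E).
  exact: emeasurable_funM.
rewrite (ge0_integralD _ measurableT f10 mf1 f20 mf2).
apply: leeD.
  rewrite (@ge0_integralZl_EFin _ _ _ P setT measurableT)//; last first.
  - exact: ltW.
  - by apply/measurable_EFinP; exact: measurable_indic.
  by rewrite integral_indic// setIT.
rewrite (@ge0_integralZl_EFin _ _ _ P setT measurableT)//; last 2 first.
- by move=> w _; rewrite lee_fin sqr_ge0.
- by rewrite invr_ge0 ltW.
rewrite mulrC EFinM lee_wpmul2l ?lee_fin ?invr_ge0 ?(ltW b0)//.
exact: quad_form_moment2.
Qed.

End quadratic_form.
End noise_moments.

(** * The Bayes lower bound *)

Section truncation.
Context {R : realType}.
Implicit Types (x y : nat -> R).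

(* Beyond twice the radius of a ball, the origin is closer to every point of the ball. *)
Definition truncate (N : nat) (rho : R) y : nat -> R :=
  fun k => if \sum_(0 <= l < N) y l ^+ 2 <= 4 * rho then y k else 0.

Lemma truncate_norm N rho y : 0 <= rho ->
  \sum_(0 <= k < N) truncate N rho y k ^+ 2 <= 4 * rho.
Proof.
move=> rho0; rewrite /truncate; set S := \sum_(0 <= l < N) y l ^+ 2.
have [//|_] := leP S (4 * rho).
by rewrite big1 ?mulr_ge0// => k _; rewrite expr0n.
Qed.

Lemma truncate_contract N rho x y :
  \sum_(0 <= k < N) x k ^+ 2 <= rho ->
  \sum_(0 <= k < N) (truncate N rho y k - x k) ^+ 2 <=
  \sum_(0 <= k < N) (y k - x k) ^+ 2.
Proof.
move=> xrho; rewrite /truncate; set S := \sum_(0 <= l < N) y l ^+ 2.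
have [//|yrho] := leP S (4 * rho).
(* From (y - 2 x)^2 >= 0. After summation the y^2 / 2 exceed 2 rho, hence the 2 x^2, and the squared
   distance to the origin is left. *)
have e : \sum_(0 <= k < N) (y k ^+ 2 / 2 - 2 * x k ^+ 2 + (0 - x k) ^+ 2) <=
    \sum_(0 <= k < N) (y k - x k) ^+ 2.
  by apply: ler_sum => k _; have := sqr_ge0 (y k - 2 * x k); lra.
apply: le_trans e; rewrite big_split/= sumrB -mulr_suml -mulr_sumr.
rewrite lerDr -/S; lra.
Qed.

End truncation.

Section lower_bound.
Local Open Scope ereal_scope.
Context {R : realType} {d : measure_display} {T : measurableType d}.
Context (P : probability T R) (xi : nat -> {RV P >-> R}).
Hypothesis xi_iid : iid_standard_gaussian xi.
Variables (a sigma : nat -> R) (r P0 eps : R).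
Hypotheses (sigma0 : forall i, (0 < sigma i)%R) (P00 : (0 < P0)%R) (eps0 : (0 < eps)%R).
Local Notation noise := (noise xi).
Local Notation tau := (fun k => eps * sigma k)%R.

Lemma besov_ball0 : besov_ball r P0 (fun=> 0%R).
Proof.
apply: ge_ereal_sup => _ [k _ <-]; rewrite eseries0 ?mule0 ?lee_fin ?ltW//.
by move=> i _ _; rewrite expr0n.
Qed.

Lemma sup_risk_ge0 delta : 0 <= sup_risk xi a sigma r P0 eps delta.
Proof.
apply: (@le_trans _ _ (risk xi a sigma eps delta (fun=> 0%R))).
  apply: integral_ge0 => w _; apply: nneseries_ge0 => k _ _.
  by rewrite lee_fin sqr_ge0.
by apply: ereal_sup_ubound; exists (fun=> 0%R) => //; exact: besov_ball0.
Qed.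

Variables (s : nat -> R) (N : nat) (G : set T) (rho : R).
Hypotheses (mG : measurable G) (rho0 : (0 <= rho)%R).
Let X := quad_form xi (fun k => s k ^+ 2)%R N.
Hypothesis GB : forall w, G w -> besov_ball r P0 (fun k => s k * noise w k)%R.
Hypothesis Grho : forall w, G w -> (X w <= rho)%R.

Let prior_loss (delta : seq_space R -> seq_space R) (w' w : T) : R :=
  (\sum_(0 <= k < N) (truncate N rho (delta (obs_map a s tau (noise w') (noise w))) k
     - s k * noise w' k) ^+ 2)%R.

Let X_sum w : X w = (\sum_(0 <= k < N) (s k * noise w k) ^+ 2)%R.
Proof. by apply: eq_bigr => k _; rewrite exprMn. Qed.

Let prior_loss_ge0 delta w' w : (0 <= prior_loss delta w' w)%R.
Proof. by apply: sumr_ge0 => k _; exact: sqr_ge0. Qed.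

(** For a draw inside the ball the averaged loss is part of a risk that the supremum dominates.
    Truncation only helps there, since the draw has squared norm at most [rho] on the first [N]
    coordinates. *)
Let prior_loss_risk delta w' : G w' ->
  \int[P]_w (prior_loss delta w' w)%:E <= sup_risk xi a sigma r P0 eps delta.
Proof.
move=> Gw'.
apply: (@le_trans _ _ (risk xi a sigma eps delta (fun k => s k * noise w' k)%R)); last first.
  by apply: ereal_sup_ubound; eexists; [exact: (GB Gw')|].
apply: ge0_le_integralT => w; first by rewrite lee_fin.
apply: le_trans (nneseries_lim_ge N _); last by move=> k _ _; rewrite lee_fin sqr_ge0.
rewrite sumEFin lee_fin; apply: truncate_contract.
by rewrite -X_sum; exact: Grho.
Qed.

(** Off the ball nothing is known of the estimator, so the truncation must bound the loss: (t - x)^2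
    <= 2 t^2 + 2 x^2, where t has squared norm at most 4 rho. *)
Let prior_loss_bad delta w' :
  \int[P]_w (prior_loss delta w' w)%:E <= (8 * rho + 2 * X w')%:E.
Proof.
have <- : \int[P]_w (8 * rho + 2 * X w')%:E = (8 * rho + 2 * X w')%:E.
  by rewrite integral_cst//= probability_setT mule1.
apply: ge0_le_integralT => w; first by rewrite lee_fin.
rewrite lee_fin X_sum /prior_loss; set t := truncate _ _ _.
apply: (@le_trans _ _ (\sum_(0 <= k < N) (2 * t k ^+ 2 + 2 * (s k * noise w' k) ^+ 2))%R).
  apply: ler_sum => k _.
  by have := sqr_ge0 (t k + s k * noise w' k); rewrite sqrrD sqrrB; lra.
rewrite big_split/= -!mulr_sumr lerD2r.
have := truncate_norm N (delta (obs_map a s tau (noise w') (noise w))) rho0; rewrite -/t; lra.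
Qed.

Let measurable_truncate (delta : seq_space R -> seq_space R) k : measurable_fun setT delta ->
  measurable_fun setT (fun y : seq_space R => truncate N rho (delta y) k).
Proof.
move=> mdelta.
have mc l : measurable_fun setT (fun y => delta y l).
  exact: (measurableT_comp (measurable_coord l) mdelta).
apply: measurable_fun_ifT => //.
apply: measurable_fun_ler => //; apply: measurable_sum => l.
exact: (measurableT_comp (exprn_measurable 2)).
Qed.

(** The sum is the Bayes risk, below the loss averaged over prior draws. Draws in [G] contribute at
    most the supremum; the last term pays for the draws outside [G], [b] being the level at which
    their quadratic form is split. *)
Lemma sup_risk_lower_bound (delta : seq_space R -> seq_space R) b p : measurable_fun setT delta -> (0 < b)%R ->
  P (~` G) <= p%:E ->
  (\sum_(0 <= k < N) (s k ^+ 2 * tau k ^+ 2 / (a k ^+ 2 * s k ^+ 2 + tau k ^+ 2)))%:E <=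
  sup_risk xi a sigma r P0 eps delta +
  (8 * rho * p + 2 * (b * p + ((\sum_(0 <= k < N) s k ^+ 2) ^+ 2 +
     128 * \sum_(0 <= k < N) (s k ^+ 2) ^+ 2) / b))%:E.
Proof.
move=> mdelta b0 Pp.
pose term k w' w := ((truncate N rho (delta (obs_map a s tau (noise w') (noise w))) k
     - s k * noise w' k) ^+ 2)%:E.
have mterm k : measurable_fun setT (fun z : T * T => term k z.1 z.2).
  apply/measurable_EFinP; apply: (measurableT_comp (exprn_measurable 2)).
  apply: measurable_funB.
    apply: (measurableT_comp (measurable_truncate k mdelta)).
    by apply: measurable_obs_map; apply: (measurableT_comp (measurable_noise xi)).
  apply: measurable_funM => //.
  exact: (measurableT_comp (measurable_noise_coord xi k)).
have term0 k w' w : 0 <= term k w' w by rewrite lee_fin sqr_ge0.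
pose L w' := \int[P]_w (prior_loss delta w' w)%:E.
have LE w' : L w' = \sum_(0 <= k < N) \int[P]_w term k w' w.
  rewrite /L; under eq_integral do rewrite /prior_loss -sumEFin.
  rewrite ge0_integral_sum//.
  - by move=> k; exact: (measurableT_comp (mterm k) (pair1_measurable w')).
  - by move=> k w _; exact: term0.
have mI k : measurable_fun setT (fun w' => \int[P]_w term k w' w).
  exact: (measurable_fun_fubini_tonelli_F (m2 := P) (fun z : T * T => term k z.1 z.2)).
have mL : measurable_fun setT L.
  by rewrite (funext LE); exact: emeasurable_sum.
have L0 w' : 0 <= L w' by apply: integral_ge0 => w _; rewrite lee_fin.
apply: (@le_trans _ _ (\int[P]_w' L w')).
  under eq_integral do rewrite LE.
  rewrite ge0_integral_sum//; last by move=> k w' _; apply: integral_ge0.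
  rewrite -sumEFin; apply: lee_sum => k _.
  have tau0 : (0 < tau k)%R by exact: mulr_gt0.
  exact: (bayes_coord xi_iid a s tau0 (measurable_truncate k mdelta)).
have mGC : measurable (~` G) by exact: measurableC.
rewrite -(setvU G) ge0_integral_setU//; last 2 first.
- by rewrite setvU.
- by rewrite disj_set2E setICl.
rewrite addeC; apply: leeD.
  apply: (@le_trans _ _ (\int[P]_(w' in G) sup_risk xi a sigma r P0 eps delta)).
    rewrite integral_mkcond [leRHS]integral_mkcond.
    apply: ge0_le_integralT => w'; rewrite !patchE; case: ifPn => // /set_mem.
    exact: prior_loss_risk.
  rewrite integral_cst//= -[leRHS]mule1.
  by apply: lee_wpmul2l; [exact: sup_risk_ge0|exact: probability_le1].
have X0 w : (0 <= X w)%R by apply: quad_form_ge0 => k; exact: sqr_ge0.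
have mX : measurable_fun setT X by exact: measurable_quad_form.
apply: (@le_trans _ _ (\int[P]_(w' in ~` G) ((8 * rho)%:E + 2%:E * (X w')%:E))).
  rewrite integral_mkcond [leRHS]integral_mkcond.
  apply: ge0_le_integralT => w'; rewrite !patchE; case: ifPn => //= _.
  exact: prior_loss_bad.
have f10 w : (~` G) w -> 0 <= (8 * rho)%:E by move=> _; rewrite lee_fin mulr_ge0.
have f30 w : (~` G) w -> 0 <= (X w)%:E by move=> _; rewrite lee_fin.
have f20 w : (~` G) w -> 0 <= 2%:E * (X w)%:E by move=> Gw; rewrite mule_ge0 ?lee_fin.
have mf3 : measurable_fun (~` G) (fun w => (X w)%:E).
  by apply/measurable_EFinP; exact: measurable_funTS.
have mf2 : measurable_fun (~` G) (fun w => 2%:E * (X w)%:E) by exact: emeasurable_funM.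
rewrite (ge0_integralD _ mGC f10 (measurable_cst _) f20 mf2).
rewrite integral_cst//= [leRHS]EFinD; apply: leeD.
  by rewrite [leRHS]EFinM lee_wpmul2l// lee_fin mulr_ge0.
rewrite (ge0_integralZl_EFin _ mGC f30 mf3)//.
rewrite [leRHS]EFinM lee_wpmul2l//.
have sq0 k : (0 <= s k ^+ 2)%R by exact: sqr_ge0.
apply: (le_trans (integral_quad_form_on xi_iid N sq0 mGC b0)).
by rewrite [leRHS]EFinD leeD2r// EFinM lee_wpmul2l// lee_fin ltW.
Qed.

Lemma minimax_lower_bound b p : (0 < b)%R -> P (~` G) <= p%:E ->
  (\sum_(0 <= k < N) (s k ^+ 2 * tau k ^+ 2 / (a k ^+ 2 * s k ^+ 2 + tau k ^+ 2)) -
  (8 * rho * p + 2 * (b * p + ((\sum_(0 <= k < N) s k ^+ 2) ^+ 2 +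
     128 * \sum_(0 <= k < N) (s k ^+ 2) ^+ 2) / b)))%:E <=
  minimax_risk xi a sigma r P0 eps.
Proof.
move=> b0 Pp; apply: le_ereal_inf_tmp => _ [delta [mdelta _] <-].
by rewrite EFinB leeBlDr//; exact: sup_risk_lower_bound.
Qed.

End lower_bound.

(** * The extremal prior *)

Section weights.
Context {R : realType}.
Variables (r P0 : R).
Hypotheses (r0 : 0 < r) (P00 : 0 < P0).

(** Convexity of x^-al, obtained without derivatives: 1 - al l <= expR (- al l) for l = ln (y / x),
    and l <= y / x - 1. *)
Lemma powR_tangent (al x y : R) : 0 < al -> 0 < x -> 0 < y ->
  (x `^ al)^-1 - al * (y - x) / x `^ (al + 1) <= (y `^ al)^-1.
Proof.
move=> al0 x0 y0.
have xa0 : 0 < x `^ al by rewrite powR_gt0.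
have xn0 : x != 0 by rewrite gt_eqF.
have xan0 : x `^ al != 0 by rewrite gt_eqF.
have -> : x `^ (al + 1) = x `^ al * x.
  by rewrite powRD ?xn0 ?implybT// powRr1// ltW.
have -> : (y `^ al)^-1 = (x `^ al)^-1 * expR (- (al * ln (y / x))).
  rewrite lnM ?posrE ?invr_gt0// lnV ?posrE//.
  rewrite /powR !gt_eqF// -!expRN -expRD; congr expR; ring.
have -> : (x `^ al)^-1 - al * (y - x) / (x `^ al * x) =
          (x `^ al)^-1 * (1 - al * (y / x - 1)) by field; rewrite xn0 xan0.
rewrite ler_wpM2l ?invr_ge0 ?(ltW xa0)//.
apply: le_trans (expR_ge1Dx _).
have l : ln (y / x) <= y / x - 1.
  have := @le_ln1Dx R (y / x - 1).
  by rewrite (_ : 1 + (y / x - 1) = y / x); [apply; rewrite ltrBrDl addrN divr_gt0|ring].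
by rewrite lerD2l lerN2 ler_wpM2l// ltW.
Qed.

(** The ball bounds the tail sum from index [k] by [P0 * weight k.+1]. For r > 0 the value at 0 is
    the default 0, not infinity, hence the positivity side conditions. *)
Definition weight (n : nat) : R := (n%:R `^ (2 * r))^-1.

Definition prior_var (k : nat) : R := 2 * r * P0 / k.+1%:R `^ (2 * r + 1).

Let r20 : 0 < 2 * r. Proof. by rewrite mulr_gt0. Qed.

Lemma weight_gt0 n : (0 < n)%N -> 0 < weight n.
Proof. by move=> n0; rewrite invr_gt0 powR_gt0 ?ltr0n. Qed.

Lemma weightM m n : weight (m * n) = weight m * weight n.
Proof. by rewrite /weight natrM powRM// invfM. Qed.

Lemma weight_le m n : (0 < m)%N -> (m <= n)%N -> weight n <= weight m.
Proof.
move=> m0 mn; have n0 : (0 < n)%N by exact: leq_trans mn.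
rewrite lef_pV2 ?posrE ?powR_gt0 ?ltr0n//.
by rewrite ge0_ler_powR ?nnegrE ?ler_nat// ltW.
Qed.

Lemma prior_var_gt0 k : 0 < prior_var k.
Proof. by rewrite divr_gt0 ?powR_gt0 ?mulr_gt0 ?ltr0n. Qed.

Lemma prior_var_ge k : P0 * (weight k.+1 - weight k.+2) <= prior_var k.
Proof.
have := @powR_tangent (2 * r) k.+1%:R k.+2%:R r20 (ltr0Sn _ _) (ltr0Sn _ _).
rewrite -natrB// subSnn mulr1 lerBlDr -lerBlDl => h.
by rewrite /prior_var [2 * r * P0]mulrC -mulrA ler_wpM2l ?(ltW P00).
Qed.

(** The tangent is taken at the right end of the unit interval, where [prior_var_ge] takes the left
    one; hence the index shift between the two telescoped bounds. *)
Lemma prior_var_le k : prior_var k.+1 <= P0 * (weight k.+1 - weight k.+2).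
Proof.
have := @powR_tangent (2 * r) k.+2%:R k.+1%:R r20 (ltr0Sn _ _) (ltr0Sn _ _).
have -> : k.+1%:R - k.+2%:R = -1 :> R by rewrite -[k.+2]addn1 natrD; ring.
rewrite mulrN1 mulNr opprK addrC -lerBrDr => h.
by rewrite /prior_var [2 * r * P0]mulrC -mulrA ler_wpM2l ?(ltW P00).
Qed.

Lemma sum_prior_var_ge m n : (m <= n)%N ->
  P0 * (weight m.+1 - weight n.+1) <= \sum_(m <= k < n) prior_var k.
Proof.
move=> mn; rewrite -(subnKC mn); elim: (n - m)%N => [|k IH].
  by rewrite addn0 big_geq// subrr mulr0.
rewrite addnS big_nat_recr ?leq_addr//=.
have := prior_var_ge (m + k); rewrite !mulrBr in IH *; lra.
Qed.

Lemma sum_prior_var_le m n : (0 < m)%N -> (m <= n)%N ->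
  \sum_(m <= k < n) prior_var k <= P0 * (weight m - weight n).
Proof.
move=> m0 mn; rewrite -(subnKC mn); elim: (n - m)%N => [|k IH].
  by rewrite addn0 big_geq// subrr mulr0.
rewrite addnS big_nat_recr ?leq_addr//=.
have := prior_var_le (m + k).-1; rewrite prednK ?addn_gt0 ?m0//.
rewrite !mulrBr in IH *; lra.
Qed.

Lemma weight_small e : 0 < e -> exists2 n, (0 < n)%N & weight n <= e.
Proof.
move=> e0; pose B := (e^-1 `^ (2 * r)^-1).
have B0 : 0 < B by rewrite powR_gt0 ?invr_gt0.
exists (Num.truncn B).+1 => //.
rewrite /weight -[leRHS]invrK lef_pV2 ?posrE ?powR_gt0 ?invr_gt0//.
have -> : e^-1 = B `^ (2 * r).
  by rewrite -powRrM mulVf ?gt_eqF// powRr1// invr_ge0 ltW.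
rewrite ge0_ler_powR ?nnegrE ?(ltW r20) ?(ltW B0)//.
by rewrite ltW// truncnS_gt.
Qed.

(** One step multiplies the weight by at least 1 - 2 r / l >= 1 - del / 2, and (1 - del / 2)^2 >= 1
    - del: half of the slack [del] survives the step. *)
Lemma weight_slow (del : R) q l : 0 < del -> del < 1 -> (0 < q)%N ->
  4 * r <= del * q%:R -> (q <= l)%N ->
  (1 - del) * weight l <= (1 - del / 2) * weight l.+1.
Proof.
move=> del0 del1 q0 rq ql; have l0 : (0 < l)%N by exact: leq_trans ql.
have lR : 0 < l%:R :> R by rewrite ltr0n.
have := @powR_tangent (2 * r) l%:R l.+1%:R r20 lR (ltr0Sn _ _).
have ln0 : l%:R != 0 :> R by rewrite gt_eqF.
rewrite -natrB// subSnn mulr1 powRD ?ln0 ?implybT// powRr1 ?(ltW lR)// => h.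
have {}h : weight l * (1 - 2 * r / l%:R) <= weight l.+1.
  apply: le_trans h; rewrite /weight le_eqVlt; apply/orP; left; apply/eqP.
  by field; rewrite !gt_eqF// powR_gt0.
have w0 := weight_gt0 l0.
have h2 : 2 * r / l%:R <= del / 2.
  rewrite ler_pdivrMr//.
  have : (q%:R <= l%:R :> R) by rewrite ler_nat.
  by nra.
have : (1 - del / 2) * (weight l * (1 - 2 * r / l%:R)) <= (1 - del / 2) * weight l.+1.
  by rewrite ler_wpM2l//; lra.
apply: le_trans.
have h3 : 1 - del <= (1 - del / 2) * (1 - 2 * r / l%:R) by nra.
by rewrite mulrCA mulrC ler_wpM2l// ltW.
Qed.

End weights.

Lemma nneseries_ub (R : realType) (u : nat -> R) (m : nat) (B : R) :
  (forall k, 0 <= u k) -> (forall n, \sum_(m <= k < n) u k <= B) ->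
  (\sum_(m <= k <oo) (u k)%:E <= B%:E)%E.
Proof.
move=> u0 uB; apply: lime_le.
  by apply: is_cvg_nneseries => k _ _; rewrite lee_fin.
by apply: nearW => n; rewrite sumEFin lee_fin.
Qed.

(** * The block prior stays in the ball with high probability *)

Section good_event.
Context {R : realType} {d : measure_display} {T : measurableType d}.
Context (P : probability T R) (xi : nat -> {RV P >-> R}).
Hypothesis xi_iid : iid_standard_gaussian xi.
Variables (r P0 del : R) (q Q n : nat).
Hypotheses (r0 : 0 < r) (P00 : 0 < P0) (del0 : 0 < del) (del1 : del < 1).
Hypotheses (q0 : (0 < q)%N) (qQ : (q < Q)%N) (n0 : (0 < n)%N).
Hypothesis rq : 4 * r <= del * q%:R.
Local Notation noise := (noise xi).
Local Notation w_ := (weight r).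
Local Notation v := (prior_var r P0).

(** [n] will grow as the noise vanishes while [q] and [Q] stay fixed. The factor 1 - del leaves room
    under the constraints of the ball. *)
Definition block_var (k : nat) : R :=
  if (q * n <= k < Q * n)%N then (1 - del) * v k else 0.

Definition block_sd (k : nat) : R := Num.sqrt (block_var k).

Lemma block_var_ge0 k : 0 <= block_var k.
Proof.
rewrite /block_var; case: ifP => // _.
by rewrite mulr_ge0 ?(ltW (prior_var_gt0 _ _ _))// subr_ge0 ltW.
Qed.

Lemma block_var_le k : block_var k <= v k.
Proof.
have v0 := prior_var_gt0 r0 P00 k.
rewrite /block_var; case: ifP => _; last exact: ltW.
by rewrite ler_piMl ?(ltW v0)// gerBl ltW.
Qed.

Lemma block_sd2 k : block_sd k ^+ 2 = block_var k.
Proof. by rewrite sqr_sqrtr// block_var_ge0. Qed.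

Let cut l k := if (l * n <= k)%N then block_var k else 0.

Let cut_ge0 l k : 0 <= cut l k.
Proof. by rewrite /cut; case: ifP => // _; exact: block_var_ge0. Qed.

Let tail l := quad_form xi (cut l) (Q * n).

(* Checking the constraints of the ball at the multiples of [n] is enough, and
   leaves a number of events that does not grow with [n]. *)
Definition good_event : set T :=
  [set w | forall l, (q <= l < Q)%N -> tail l w <= P0 * w_ (l.+1 * n)].

Let mtail l : measurable_fun setT (tail l).
Proof. exact: measurable_quad_form. Qed.

Let bad l : set T := [set w | (q <= l < Q)%N /\ P0 * w_ (l.+1 * n) < tail l w].

Let mbad l : measurable (bad l).
Proof.
have [ql|ql] := boolP (q <= l < Q)%N; last first.
  rewrite (_ : bad l = set0)//; apply/seteqP; split => w //= -[h _].
  by rewrite h in ql.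
rewrite (_ : bad l = [set w | P0 * w_ (l.+1 * n) < tail l w]); last first.
  by apply/seteqP; split => w /=; [case|split].
rewrite -[X in measurable X]setTI.
exact: (measurable_fun_ltr (measurable_cst _) (mtail l)).
Qed.

Let setC_good : ~` good_event = \big[setU/set0]_(l < Q) bad l.
Proof.
rewrite -(bigcup_mkord Q bad); apply/seteqP; split => w.
  move=> /existsNP[l] /not_implyP[ql] /negP; rewrite -ltNge => h.
  by exists l => //=; case/andP: ql.
by move=> [l _ [ql h]] /(_ l ql); rewrite leNgt h.
Qed.

Lemma measurable_good_event : measurable good_event.
Proof.
rewrite -[good_event]setCK setC_good; apply: measurableC.
by apply: bigsetU_measurable => l _; exact: mbad.
Qed.

(** A union bound over at most [Q] Chebyshev estimates, without their factor 1/n. As [weight] is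
    multiplicative, [n] cancels in the squared ratio of total variance to threshold. *)
Definition bad_rate : R :=
  Q%:R * (256 * r * (w_ q / (w_ Q * (del / 2))) ^+ 2 / q%:R).

Lemma bad_rate_ge0 : 0 <= bad_rate.
Proof.
rewrite /bad_rate; apply: mulr_ge0 => //; apply: divr_ge0 => //.
by apply: mulr_ge0; [rewrite mulr_ge0// ltW|exact: sqr_ge0].
Qed.

Let qn0 : (0 < q * n)%N. Proof. by rewrite muln_gt0 q0. Qed.

Lemma sum_block_var : \sum_(0 <= k < Q * n) block_var k <= P0 * w_ (q * n).
Proof.
have qnQn : (q * n <= Q * n)%N by rewrite leq_mul2r ltnW ?orbT.
rewrite (big_cat_nat (n := q * n))//= big1_seq ?add0r; last first.
  move=> k; rewrite mem_index_iota => /andP[_ /andP[_ kqn]].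
  by rewrite /block_var leqNgt kqn.
apply: (@le_trans _ _ (\sum_(q * n <= k < Q * n) v k)).
  by apply: ler_sum => k _; exact: block_var_le.
apply: (le_trans (sum_prior_var_le r0 P00 qn0 qnQn)).
rewrite ler_wpM2l ?(ltW P00)// gerBl ltW// weight_gt0//.
exact: leq_trans qnQn.
Qed.

(** By [weight_slow], one half of the slack [del] pays for placing the threshold one multiple of [n]
    beyond the start of the tail; the other half is left for fluctuations. *)
Let cut_mean l : (q <= l < Q)%N ->
  \sum_(0 <= k < Q * n) cut l k + del / 2 * (P0 * w_ (l.+1 * n)) <= P0 * w_ (l.+1 * n).
Proof.
move=> /andP[ql lQ].
have lnQn : (l * n <= Q * n)%N by rewrite leq_mul2r ltnW ?orbT.
have l0 : (0 < l)%N by exact: leq_trans ql.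
have ln0 : (0 < l * n)%N by rewrite muln_gt0 l0.
have h : \sum_(0 <= k < Q * n) cut l k <= (1 - del) * (P0 * w_ (l * n)).
  rewrite (big_cat_nat (n := l * n))//= big1_seq ?add0r; last first.
    move=> k; rewrite mem_index_iota => /andP[_ /andP[_ kln]].
    by rewrite /cut leqNgt kln.
  apply: (@le_trans _ _ (\sum_(l * n <= k < Q * n) (1 - del) * v k)).
    apply: ler_sum => k _; rewrite /cut /block_var.
    have vk : 0 <= (1 - del) * v k by rewrite mulr_ge0 ?ltW ?prior_var_gt0 ?subr_gt0.
    by case: ifP => // _; case: ifP.
  rewrite -mulr_sumr ler_wpM2l ?subr_ge0 ?(ltW del1)//.
  apply: (le_trans (sum_prior_var_le r0 P00 ln0 lnQn)).
  rewrite ler_wpM2l ?(ltW P00)// gerBl ltW// weight_gt0//.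
  exact: leq_trans lnQn.
have slow := weight_slow r0 del0 del1 q0 rq ql.
rewrite !weightM in h *.
have Pw : 0 <= P0 * w_ n by rewrite mulr_ge0 ?ltW ?weight_gt0.
have := ler_wpM2l Pw slow; lra.
Qed.

(** Largest variance times total variance. The largest is of order weight over index near q n, which
    produces the 1/n in the probability bound. *)
Let cut_sqr l : \sum_(0 <= k < Q * n) cut l k ^+ 2 <=
  2 * r * (P0 * w_ (q * n)) ^+ 2 / (q * n)%:R.
Proof.
have qnR : 0 < (q * n)%:R :> R by rewrite ltr0n.
apply: (@le_trans _ _ (\sum_(0 <= k < Q * n)
    (2 * r * (P0 * w_ (q * n)) / (q * n)%:R) * block_var k)).
  apply: ler_sum => k _.
  apply: (@le_trans _ _ (block_var k * block_var k)).
    rewrite -expr2 /cut; case: ifP => // _.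
    by rewrite expr0n/= sqr_ge0.
  have [kqn|kqn] := boolP (q * n <= k < Q * n)%N; last first.
    by rewrite {1 3}/block_var (negbTE kqn) mul0r mulr0.
  rewrite ler_wpM2r ?block_var_ge0//.
  apply: (le_trans (block_var_le k)).
  have -> : v k = 2 * r * P0 * (w_ k.+1 / k.+1%:R).
    rewrite /prior_var /weight powRD ?pnatr_eq0 ?implybT// powRr1 ?ler0n//.
    by rewrite invfM.
  have -> : 2 * r * (P0 * w_ (q * n)) / (q * n)%:R = 2 * r * P0 * (w_ (q * n) / (q * n)%:R).
    by rewrite !mulrA.
  apply: ler_wpM2l; first by rewrite ltW// !mulr_gt0.
  case/andP: kqn => kqn _; apply: ler_pM.
  - by rewrite ltW// weight_gt0.
  - by rewrite invr_ge0.
  - by apply: weight_le => //; exact: leqW.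
  - by rewrite lef_pV2 ?posrE// ler_nat leqW.
rewrite -mulr_sumr.
apply: (@le_trans _ _ (2 * r * (P0 * w_ (q * n)) / (q * n)%:R * (P0 * w_ (q * n)))).
  rewrite ler_wpM2l ?sum_block_var//.
  by apply/ltW/divr_gt0 => //; rewrite !mulr_gt0// weight_gt0.
move: qnR; move: ((q * n)%:R : R) => D D0.
by rewrite le_eqVlt; apply/orP; left; apply/eqP; field; rewrite gt_eqF.
Qed.

Lemma good_event_prob : (P (~` good_event) <= (bad_rate / n%:R)%:E)%E.
Proof.
rewrite setC_good.
apply: (le_trans (Boole_inequality P (fun i _ => mbad i))).
apply: (@le_trans _ _ (\sum_(l < Q) (bad_rate / Q%:R / n%:R)%:E)%E); last first.
  have <- : bad_rate / Q%:R / n%:R *+ Q = bad_rate / n%:R; last first.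
    by rewrite sumEFin sumr_const card_ord.
  rewrite -(mulr_natr (_ / _)); field.
  by rewrite !pnatr_eq0 -!lt0n n0 (leq_trans _ qQ).
apply: lee_sum => l _.
have [ql|ql] := boolP (q <= l < Q)%N; last first.
  rewrite (_ : bad l = set0) ?measure0 ?lee_fin.
    by rewrite divr_ge0// divr_ge0// bad_rate_ge0.
  by apply/seteqP; split => w //= -[h _]; rewrite h in ql.
have t0 : 0 < del / 2 * (P0 * w_ (l.+1 * n)).
  apply: mulr_gt0; first by rewrite divr_gt0.
  by apply: mulr_gt0 => //; apply: weight_gt0 => //; rewrite muln_gt0.
apply: (@le_trans _ _ (P [set w | \sum_(0 <= k < Q * n) cut l k +
     del / 2 * (P0 * w_ (l.+1 * n)) <= tail l w])).
  apply: le_measure; rewrite ?inE.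
  - exact: mbad.
  - rewrite -[X in measurable X]setTI.
    exact: (measurable_fun_ler (measurable_cst _) (mtail l)).
  - by move=> w [_ /ltW h] /=; exact: le_trans (cut_mean ql) h.
apply: (le_trans (quad_form_deviation xi_iid (Q * n) (cut_ge0 l) t0)).
rewrite lee_fin.
have lQ : (l.+1 <= Q)%N by case/andP: ql.
have Q0 : (0 < Q)%N by exact: leq_trans qQ.
have wQ := weight_gt0 r Q0; have wn := weight_gt0 r n0; have wq := weight_gt0 r q0.
have wl := weight_le r0 (ltn0Sn l) lQ.
have den0 : 0 < del / 2 * (P0 * (w_ Q * w_ n)) by rewrite !mulr_gt0.
have den : del / 2 * (P0 * (w_ Q * w_ n)) <= del / 2 * (P0 * w_ (l.+1 * n)).
  rewrite weightM; do 2 (rewrite ler_wpM2l ?divr_ge0 ?(ltW del0) ?(ltW P00)//).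
  by rewrite ler_wpM2r// ltW.
apply: (@le_trans _ _ (128 * (2 * r * (P0 * w_ (q * n)) ^+ 2 / (q * n)%:R) /
    (del / 2 * (P0 * (w_ Q * w_ n))) ^+ 2)).
  apply: ler_pM.
  - by rewrite mulr_ge0// sumr_ge0// => k _; exact: sqr_ge0.
  - by rewrite invr_ge0 sqr_ge0.
  - by rewrite ler_wpM2l// cut_sqr.
  - by rewrite lef_pV2 ?posrE ?exprn_gt0// ler_pXn2r// nnegrE ltW.
rewrite le_eqVlt; apply/orP; left; apply/eqP.
rewrite /bad_rate weightM natrM; field.
by rewrite !pnatr_eq0 -!lt0n n0 q0 Q0 !gt_eqF.
Qed.

Lemma good_event_norm w : good_event w ->
  quad_form xi (fun k => block_sd k ^+ 2) (Q * n) w <= P0 * w_ (q * n).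
Proof.
move=> /(_ q); rewrite leqnn qQ => /(_ isT) h.
have -> : quad_form xi (fun k => block_sd k ^+ 2) (Q * n) w = tail q w.
  apply: eq_bigr => k _; rewrite block_sd2 /cut; case: ifPn => // /negbTE kq.
  by rewrite /block_var kq.
apply: (le_trans h); rewrite ler_wpM2l ?(ltW P00)//.
by apply: weight_le => //; rewrite leq_mul2r leqnSn orbT.
Qed.

Lemma good_event_besov w : good_event w ->
  besov_ball r P0 (fun k => block_sd k * noise w k).
Proof.
move=> Gw; apply: ge_ereal_sup => _ [k _ <-].
have kR : 0 < k.+1%:R `^ (2 * r) :> R by rewrite powR_gt0.
have ub : (\sum_(k <= i <oo) ((block_sd i * noise w i) ^+ 2)%:E <= (P0 * w_ k.+1)%:E)%E.
  apply: nneseries_ub => [i|m]; first exact: sqr_ge0.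
  have [Qk|kQ] := leqP (Q * n) k.
    rewrite big1_seq ?mulr_ge0 ?(ltW P00) ?ltW ?weight_gt0// => i /andP[_].
    rewrite mem_index_iota => /andP[ki _].
    rewrite exprMn block_sd2 /block_var ltnNge (leq_trans Qk ki) andbF mul0r//.
  (* The multiple of [n] just below [k], or the start of the block if [k] precedes it. Then [tail l]
     dominates the sum from [k], and k < (l + 1) n keeps its threshold below the bound required at
     [k]. *)
  pose l := maxn q (k %/ n).
  have lQ : (q <= l < Q)%N by rewrite leq_maxl gtn_max qQ ltn_divLR.
  apply: (@le_trans _ _ (tail l w)).
    apply: (@le_trans _ _ (\sum_(k <= i < m) cut l i * noise w i ^+ 2)).
      rewrite [leLHS]big_nat_cond [leRHS]big_nat_cond.
      apply: ler_sum => i; rewrite andbT => /andP[ki _].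
      rewrite exprMn block_sd2 /cut; case: ifPn => // li.
      rewrite /block_var [X in if X then _ else _](_ : _ = false) ?mul0r//.
      apply: contraNF li => /andP[qi _].
      rewrite /l /maxn; case: ifP => // _.
      exact: leq_trans (leq_trunc_div k n) ki.
    apply: (@le_trans _ _ (\sum_(0 <= i < maxn (maxn k m) (Q * n)) cut l i * noise w i ^+ 2)).
      have pos i : 0 <= cut l i * noise w i ^+ 2 by rewrite mulr_ge0 ?sqr_ge0.
      have [mk|km] := leqP m k; first by rewrite big_geq// sumr_ge0.
      rewrite (big_cat_nat (n := k) (m := 0%N) (p := maxn _ _))//=; last first.
        by rewrite leq_max (ltnW km).
      rewrite (big_cat_nat (n := m) (m := k) (p := maxn _ _) (ltnW km))//=; last first.
        by rewrite leq_maxl.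
      by rewrite addrCA lerDl addr_ge0// sumr_ge0.
    rewrite /tail /quad_form (big_cat_nat (n := Q * n) (m := 0%N) (p := maxn _ _))//=; last first.
      by rewrite leq_maxr.
    rewrite [X in _ + X]big1_seq ?addr0// => i; rewrite mem_index_iota => /andP[_ /andP[Qi _]].
    by rewrite /cut /block_var ltnNge Qi andbF; case: ifP; rewrite mul0r.
  apply: (le_trans (Gw l lQ)); rewrite ler_wpM2l ?(ltW P00)//.
  apply: weight_le => //.
  apply: (@leq_trans ((k %/ n).+1 * n)); first by rewrite ltn_ceil.
  by rewrite leq_mul2r ltnS leq_maxr orbT.
have k0E : (0 <= (k.+1%:R `^ (2 * r))%:E)%E by rewrite lee_fin ltW.
apply: (le_trans (lee_wpmul2l k0E ub)).
by rewrite -EFinM lee_fin mulrCA /weight divff ?mulr1// gt_eqF.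
Qed.

End good_event.

(** * Terms of the limiting risk *)

Section risk_terms.
Context {R : realType}.
Variables (a sigma : nat -> R) (r P0 : R).
Hypotheses (a_neq0 : forall i, a i != 0) (sigma_gt0 : forall i, 0 < sigma i).
Hypotheses (r0 : 0 < r) (P00 : 0 < P0).
Local Notation w_ := (weight r).
Local Notation v := (prior_var r P0).

Definition risk_term (eps : R) (k : nat) : R :=
  eps ^+ 2 * (sigma k ^+ 2 / tikhonov_denom a sigma r P0 eps k).

Lemma tikhonov_denomE eps k :
  tikhonov_denom a sigma r P0 eps k = a k ^+ 2 + (eps * sigma k) ^+ 2 / v k.
Proof.
rewrite /tikhonov_denom /prior_var exprMn; congr (_ + _).
have p0 : k.+1%:R `^ (2 * r + 1) != 0 :> R by rewrite gt_eqF// powR_gt0.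
by field; rewrite p0 !gt_eqF.
Qed.

Lemma tikhonov_denom_gt0 eps k : 0 < tikhonov_denom a sigma r P0 eps k.
Proof.
rewrite tikhonov_denomE ltr_pwDl//; first by rewrite exprn_even_gt0/=.
by rewrite divr_ge0 ?sqr_ge0// ltW// prior_var_gt0.
Qed.

Lemma risk_termE eps k : risk_term eps k =
  v k * (eps * sigma k) ^+ 2 / (a k ^+ 2 * v k + (eps * sigma k) ^+ 2).
Proof.
have v0 := prior_var_gt0 r0 P00 k.
have a2 : 0 < a k ^+ 2 by rewrite exprn_even_gt0/=.
have e2 : 0 <= (eps * sigma k) ^+ 2 by exact: sqr_ge0.
have d1 : a k ^+ 2 * v k + (eps * sigma k) ^+ 2 != 0.
  by rewrite gt_eqF// ltr_pwDl// mulr_gt0.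
rewrite /risk_term tikhonov_denomE.
have -> : a k ^+ 2 + (eps * sigma k) ^+ 2 / v k =
    (a k ^+ 2 * v k + (eps * sigma k) ^+ 2) / v k by field; rewrite gt_eqF.
by rewrite invf_div; move: d1; set D := _ + _ => D0; field.
Qed.

Lemma risk_term_ge0 eps k : 0 <= risk_term eps k.
Proof.
by rewrite mulr_ge0 ?sqr_ge0// divr_ge0 ?sqr_ge0// ltW// tikhonov_denom_gt0.
Qed.

Lemma risk_term_le_var eps k : risk_term eps k <= v k.
Proof.
have v0 := prior_var_gt0 r0 P00 k.
have a2 : 0 < a k ^+ 2 by rewrite exprn_even_gt0/=.
have e2 : 0 <= (eps * sigma k) ^+ 2 by exact: sqr_ge0.
have av : 0 < a k ^+ 2 * v k by rewrite mulr_gt0.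
rewrite risk_termE ler_pdivrMr ?ltr_pwDl// ler_wpM2l ?(ltW v0)//.
by rewrite lerDr ltW.
Qed.

Lemma risk_term_le_noise eps k : risk_term eps k <= eps ^+ 2 * (sigma k ^+ 2 / a k ^+ 2).
Proof.
have a2 : 0 < a k ^+ 2 by rewrite exprn_even_gt0/=.
rewrite /risk_term ler_wpM2l ?sqr_ge0// ler_wpM2l ?sqr_ge0//.
rewrite lef_pV2 ?posrE ?tikhonov_denom_gt0// tikhonov_denomE lerDl.
by rewrite divr_ge0 ?sqr_ge0// ltW// prior_var_gt0.
Qed.

(** Signal-to-noise ratio at noise level one. Its position relative to eps^2 tells which of the two
    upper bounds on a term, [prior_var] or the unbiased noise variance, is sharp up to a factor
    2. *)
Definition snr (k : nat) : R := a k ^+ 2 * v k / sigma k ^+ 2.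

Lemma risk_term_ge_var eps k : 0 < eps -> snr k <= eps ^+ 2 -> v k / 2 <= risk_term eps k.
Proof.
move=> eps0; have v0 := prior_var_gt0 r0 P00 k.
have a2 : 0 < a k ^+ 2 by rewrite exprn_even_gt0/=.
have s2 : 0 < sigma k ^+ 2 by rewrite exprn_gt0.
rewrite /snr ler_pdivrMr// -exprMn => h.
have av : 0 < a k ^+ 2 * v k by rewrite mulr_gt0.
have e2 : 0 < (eps * sigma k) ^+ 2 by rewrite exprn_gt0// mulr_gt0.
rewrite risk_termE ler_pdivlMr ?addr_gt0// -mulrA ler_wpM2l ?(ltW v0)//.
lra.
Qed.

Lemma risk_term_ge_noise eps k : 0 < eps -> eps ^+ 2 <= snr k ->
  eps ^+ 2 * (sigma k ^+ 2 / a k ^+ 2) <= 2 * risk_term eps k.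
Proof.
move=> eps0; have v0 := prior_var_gt0 r0 P00 k.
have a2 : 0 < a k ^+ 2 by rewrite exprn_even_gt0/=.
have s2 : 0 < sigma k ^+ 2 by rewrite exprn_gt0.
rewrite /snr ler_pdivlMr// -exprMn => h.
have av : 0 < a k ^+ 2 * v k by rewrite mulr_gt0.
have e2 : 0 < (eps * sigma k) ^+ 2 by rewrite exprn_gt0// mulr_gt0.
rewrite risk_termE mulrA (_ : _ * (_ / _) = (eps * sigma k) ^+ 2 / a k ^+ 2); last first.
  by rewrite exprMn mulrA.
rewrite ler_pdivlMr ?addr_gt0// mulrAC ler_pdivrMr//.
rewrite (_ : 2 * _ * _ = (eps * sigma k) ^+ 2 * (2 * (a k ^+ 2 * v k))); last by ring.
rewrite ler_wpM2l ?(ltW e2)//; lra.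
Qed.

(** Trades the series for a real [S] known through its partial sums. Convergence and the size of the
    remainder both come from the domination by [prior_var], whose sums telescope. *)
Lemma risk_series eps : exists S : R,
  [/\ ((eps ^+ 2)%:E * \sum_(0 <= i <oo)
          (sigma i ^+ 2 / tikhonov_denom a sigma r P0 eps i)%:E)%E = S%:E,
      (\sum_(0 <= i <oo) (risk_term eps i)%:E)%E = S%:E,
      (forall N, \sum_(0 <= k < N) risk_term eps k <= S) &
      (forall N, (0 < N)%N -> S <= \sum_(0 <= k < N) risk_term eps k + P0 * w_ N)].
Proof.
have -> : ((eps ^+ 2)%:E * \sum_(0 <= i <oo)
    (sigma i ^+ 2 / tikhonov_denom a sigma r P0 eps i)%:E)%E =
    (\sum_(0 <= i <oo) (risk_term eps i)%:E)%E.
  rewrite -nneseriesZl//.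
  by move=> i _; rewrite lee_fin divr_ge0 ?sqr_ge0// ltW// tikhonov_denom_gt0.
have ub N : (0 < N)%N -> (\sum_(0 <= i <oo) (risk_term eps i)%:E <=
    (\sum_(0 <= k < N) risk_term eps k + P0 * w_ N)%:E)%E.
  move=> N0; apply: nneseries_ub => [k|n]; first exact: risk_term_ge0.
  have wN : 0 <= P0 * w_ N by rewrite mulr_ge0 ?ltW ?weight_gt0.
  have [nN|Nn] := leqP n N.
    rewrite (big_cat_nat (n := n) (p := N))//= -addrA lerDl addr_ge0// sumr_ge0// => k _.
    exact: risk_term_ge0.
  rewrite (big_cat_nat (n := N) (p := n) _ (ltnW Nn))//= lerD2l.
  apply: (@le_trans _ _ (\sum_(N <= k < n) v k)).
    by apply: ler_sum => k _; exact: risk_term_le_var.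
  apply: (le_trans (sum_prior_var_le r0 P00 N0 (ltnW Nn))).
  by rewrite ler_wpM2l ?(ltW P00)// gerBl ltW// weight_gt0// (ltn_trans N0).
have lb N : ((\sum_(0 <= k < N) risk_term eps k)%:E <= \sum_(0 <= i <oo) (risk_term eps i)%:E)%E.
  rewrite -sumEFin; apply: nneseries_lim_ge => k _ _.
  by rewrite lee_fin risk_term_ge0.
move: ub lb; case: (\sum_(0 <= i <oo) _)%E => [S|/(_ 1 isT)|_ /(_ 0%N)].
- by move=> ub lb; exists S; split.
- by rewrite leye_eq.
- by rewrite leeNy_eq.
Qed.

End risk_terms.

(** * Asymptotic lower bound for the minimax risk *)

Section lower_asymptotics.
Context {R : realType} {d : measure_display} {T : measurableType d}.
Context (P : probability T R) (xi : nat -> {RV P >-> R}).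
Variables (a sigma : nat -> R) (r P0 : R) (i0 : nat) (c C : R).
Hypotheses (xi_iid : iid_standard_gaussian xi)
    (a_bounded : bounded_fun a)
    (a_neq0 : forall i, a i != 0)
    (sigma_gt0 : forall i, 0 < sigma i)
    (r_gt0 : 0 < r) (P0_gt0 : 0 < P0)
    (a_decr : forall i, (i0 < i)%N -> 1 <= `|a i / a i.+1|)
    (c_gt0 : 0 < c)
    (sigma_bounds : forall i, c < sigma i ^+ 2 < C)
    (ratio_gt1 : forall i, (i0 < i)%N ->
      1 < (sigma i ^+ 2 * a i.-1 ^+ 2 * i.+1%:R `^ (2 * r + 1)) /
          (sigma i.-1 ^+ 2 * a i ^+ 2 * i%:R `^ (2 * r + 1))).
Local Notation w_ := (weight r).
Local Notation v := (prior_var r P0).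
Local Notation rt := (risk_term a sigma r P0).
Local Notation snr_ := (snr a sigma r P0).

Let a2_gt0 i : 0 < a i ^+ 2. Proof. by rewrite exprn_even_gt0/=. Qed.
Let s2_gt0 i : 0 < sigma i ^+ 2. Proof. by rewrite exprn_gt0. Qed.

Lemma snr_gt0 k : 0 < snr_ k.
Proof. by rewrite divr_gt0// mulr_gt0// prior_var_gt0. Qed.

(** After clearing denominators this is [ratio_gt1], the common factor 2 r P0 cancelling. *)
Lemma snr_decr i : (i0 < i)%N -> snr_ i < snr_ i.-1.
Proof.
move=> i0i; have := ratio_gt1 i0i; have i_gt0 : (0 < i)%N by exact: leq_ltn_trans i0i.
have pi : 0 < i%:R `^ (2 * r + 1) :> R by rewrite powR_gt0// ltr0n.
have pi1 : 0 < i.+1%:R `^ (2 * r + 1) :> R by rewrite powR_gt0// ltr0n.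
rewrite ltr_pdivlMr; last by apply: mulr_gt0 => //; apply: mulr_gt0.
rewrite mul1r /snr /prior_var prednK// => h.
have k0 : 0 < 2 * r * P0 by rewrite !mulr_gt0.
move: h pi pi1; set p := i%:R `^ _; set p1 := i.+1%:R `^ _ => h pi pi1.
have -> : a i ^+ 2 * (2 * r * P0 / p1) / sigma i ^+ 2 =
    2 * r * P0 * a i ^+ 2 / (p1 * sigma i ^+ 2) by field; rewrite !gt_eqF.
have -> : a i.-1 ^+ 2 * (2 * r * P0 / p) / sigma i.-1 ^+ 2 =
    2 * r * P0 * a i.-1 ^+ 2 / (p * sigma i.-1 ^+ 2) by field; rewrite !gt_eqF.
rewrite ltr_pdivrMr; last exact: mulr_gt0.
rewrite [ltRHS]mulrAC ltr_pdivlMr; last exact: mulr_gt0.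
by move: h; rewrite -(ltr_pM2l k0); congr (_ < _); ring.
Qed.

Lemma snr_le k l : (i0 <= k)%N -> (k <= l)%N -> snr_ l <= snr_ k.
Proof.
move=> ik kl; rewrite -(subnKC kl); elim: (l - k)%N => [|n IH]; first by rewrite addn0.
rewrite addnS; apply: le_trans IH; apply/ltW; apply: (@snr_decr (k + n).+1).
by rewrite ltnS (leq_trans ik)// leq_addr.
Qed.

Lemma a_sqr_bounded : exists2 A, 0 < A & forall i, a i ^+ 2 <= A.
Proof.
have [M [Mreal MA]] := a_bounded.
pose B := `|M| + 1; have B0 : 0 < B by rewrite ltr_pwDr.
exists (B ^+ 2); first by rewrite exprn_gt0.
move=> i; rewrite -(real_normK (num_real (a i))) ler_pXn2r ?nnegrE ?(ltW B0)//.
apply: MA => //; rewrite (le_lt_trans (ler_norm M))// ltrDl//.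
Qed.

Lemma snr_small e : 0 < e -> exists2 k, (i0 < k)%N & snr_ k <= e.
Proof.
move=> e0; have [A A0 aA] := a_sqr_bounded.
have [n n0 wn] := @weight_small R r r_gt0 (e * c / (A * P0)) ltac:(by rewrite !divr_gt0 ?mulr_gt0).
pose k := (n + i0).+1.
exists k; first by rewrite ltnS leq_addl.
rewrite /snr ler_pdivrMr//.
have vk : v k <= P0 * w_ n.
  apply: (le_trans (prior_var_le r_gt0 P0_gt0 _)); rewrite ler_wpM2l ?(ltW P0_gt0)//.
  apply: (@le_trans _ _ (w_ k)); first by rewrite gerBl ltW// weight_gt0.
  by apply: weight_le => //; rewrite /k -addSn; rewrite leqW// leq_addr.
apply: (@le_trans _ _ (A * (P0 * (e * c / (A * P0))))).
  apply: ler_pM => //; [exact: ltW|by rewrite ltW// prior_var_gt0|].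
  by apply: (le_trans vk); rewrite ler_wpM2l ?(ltW P0_gt0).
rewrite (_ : A * _ = e * c); last by field; rewrite !gt_eqF.
by rewrite ler_wpM2l ?(ltW e0)//; have /andP[/ltW] := sigma_bounds k.
Qed.

(** Take the least index beyond [i0] at which the ratio has dropped to eps^2. Monotonicity handles
    the indices after it and minimality those before; the indices up to [i0] stay uncontrolled. *)
Lemma crossover eps : 0 < eps -> exists m, [/\ (i0 < m)%N,
  forall k, (m <= k)%N -> snr_ k <= eps ^+ 2 &
  forall k, (i0 < k < m)%N -> eps ^+ 2 <= snr_ k].
Proof.
move=> eps0; have ex : exists k, (i0 < k)%N && (snr_ k <= eps ^+ 2).
  have [|k ik sk] := @snr_small (eps ^+ 2); first by rewrite exprn_gt0.
  by exists k; rewrite ik.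
case: (ex_minnP ex) => m /andP[im sm] mmin.
exists m; split => // k.
  by move=> mk; apply: le_trans sm; apply: snr_le => //; exact: ltnW.
move=> /andP[ik km]; rewrite leNgt; apply/negP => sk.
by have := mmin k; rewrite ik (ltW sk) => /(_ isT); rewrite leqNgt km.
Qed.

(** Beyond [i0] the |a_k| do not increase, so only the oscillation C / c of the sigma_k^2 is lost.
    The finitely many earlier ratios are at most their sum [D], while every ratio is at least c /
    A. *)
Lemma noise_ratio_bounded : exists2 Gam, 0 < Gam &
  forall k l, (k <= l)%N -> sigma k ^+ 2 / a k ^+ 2 <= Gam * (sigma l ^+ 2 / a l ^+ 2).
Proof.
have [A A0 aA] := a_sqr_bounded.
pose D := \sum_(0 <= i < i0.+1) sigma i ^+ 2 / a i ^+ 2.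
have D0 : 0 <= D by apply: sumr_ge0 => i _; rewrite divr_ge0 ?sqr_ge0.
have C0 : 0 < C by have /andP[c1 c2] := sigma_bounds 0%N; rewrite (lt_trans c_gt0)// (lt_trans c1).
have DAc0 : 0 <= D * A / c := divr_ge0 (mulr_ge0 D0 (ltW A0)) (ltW c_gt0).
exists (C / c + D * A / c); first by rewrite ltr_pwDl// divr_gt0.
move=> k l kl.
have sl : c <= sigma l ^+ 2 by have /andP[/ltW] := sigma_bounds l.
have [ik|ki] := ltnP i0 k.
  have al : a l ^+ 2 <= a k ^+ 2.
    rewrite -(subnKC kl); elim: (l - k)%N => [|n IH]; first by rewrite addn0.
    rewrite addnS; apply: le_trans IH.
    have := a_decr (leq_trans ik (leq_addr n k)).
    rewrite normrM normfV ler_pdivlMr ?normr_gt0// mul1r => h.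
    rewrite -(real_normK (num_real (a (k + n)))) -(real_normK (num_real (a (k + n).+1))).
    by rewrite ler_pXn2r ?nnegrE.
  apply: (@le_trans _ _ (C / c * (sigma l ^+ 2 / a l ^+ 2))); last first.
    by rewrite ler_wpM2r ?divr_ge0 ?sqr_ge0// lerDl.
  rewrite mulrA; apply: ler_pM; rewrite ?invr_ge0 ?sqr_ge0//; last first.
    by rewrite lef_pV2 ?posrE.
  apply: (@le_trans _ _ C); first by have /andP[_ /ltW] := sigma_bounds k.
  by rewrite mulrAC ler_pdivlMr// ler_wpM2l// ltW.
apply: (@le_trans _ _ (D * A / c * (sigma l ^+ 2 / a l ^+ 2))); last first.
  rewrite ler_wpM2r ?divr_ge0 ?sqr_ge0// lerDr.
  exact: divr_ge0 (ltW C0) (ltW c_gt0).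
apply: (@le_trans _ _ D).
  rewrite /D (bigD1_seq k) ?iota_uniq ?mem_index_iota ?ltnS//=.
  by rewrite lerDl sumr_ge0// => i _; rewrite divr_ge0 ?sqr_ge0.
have -> : D * A / c * (sigma l ^+ 2 / a l ^+ 2) =
    D * ((A / a l ^+ 2) * (sigma l ^+ 2 / c)) by field; rewrite a_neq0 gt_eqF.
by rewrite ler_peMr// mulr_ege1// ler_pdivlMr ?mul1r.
Qed.

(** Each of the first [K] terms is at most 2 Gam times each term between [K] and the crossover;
    averaging over the latter bounds the share of the former by 2 Gam K / (m - K). *)
Lemma low_frequencies Gam eps S m K : 0 < eps -> 0 <= Gam ->
  (forall k l, (k <= l)%N -> sigma k ^+ 2 / a k ^+ 2 <= Gam * (sigma l ^+ 2 / a l ^+ 2)) ->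
  (forall N, \sum_(0 <= k < N) rt eps k <= S) ->
  (forall k, (i0 < k < m)%N -> eps ^+ 2 <= snr_ k) ->
  (i0 < K)%N -> (K <= m)%N ->
  (m - K)%:R * \sum_(0 <= k < K) rt eps k <= 2 * Gam * K%:R * S.
Proof.
move=> eps0 Gam0 GamP Sub snrm iK Km.
have rt0 k : 0 <= rt eps k by exact: risk_term_ge0.
have h k l : (k < K)%N -> (K <= l < m)%N -> rt eps k <= 2 * Gam * rt eps l.
  move=> kK /andP[Kl lm].
  apply: (le_trans (risk_term_le_noise sigma a_neq0 r_gt0 P0_gt0 eps k)).
  have kl : (k <= l)%N by rewrite ltnW// (leq_trans kK).
  have e := risk_term_ge_noise a_neq0 sigma_gt0 r_gt0 P0_gt0 eps0 (snrm l _).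
  have {}e := e ltac:(by rewrite lm (leq_trans iK)).
  apply: (@le_trans _ _ (eps ^+ 2 * (Gam * (sigma l ^+ 2 / a l ^+ 2)))).
    by rewrite ler_wpM2l ?sqr_ge0// GamP.
  by have := ler_wpM2l Gam0 e; lra.
apply: (@le_trans _ _ (\sum_(K <= l < m) \sum_(0 <= k < K) rt eps k)).
  by rewrite sumr_const_nat mulr_natl.
apply: (@le_trans _ _ (\sum_(K <= l < m) (2 * Gam * K%:R) * rt eps l)).
  rewrite [leLHS]big_nat_cond [leRHS]big_nat_cond.
  apply: ler_sum => l; rewrite andbT => Klm.
  apply: (@le_trans _ _ (\sum_(0 <= k < K) 2 * Gam * rt eps l)).
    rewrite [leLHS]big_nat_cond [leRHS]big_nat_cond.
    by apply: ler_sum => k; rewrite andbT => /andP[_ kK]; exact: h.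
  by rewrite sumr_const_nat subn0 -(mulr_natl _ K); lra.
rewrite -mulr_sumr ler_wpM2l ?mulr_ge0//.
apply: le_trans (Sub m); rewrite (big_cat_nat (m := 0%N) (n := K) (p := m))//=.
by rewrite lerDr sumr_ge0.
Qed.

Definition tail_const : R := P0 / 2 * (1 - w_ 2).

Lemma tail_const_gt0 : 0 < tail_const.
Proof.
rewrite mulr_gt0 ?divr_gt0// subr_gt0 /weight invf_lt1 ?powR_gt0//.
have r2 : 0 < 2 * r by rewrite mulr_gt0.
have := @gt0_ltr_powR R (2 * r) r2 1 2; rewrite !nnegrE powR1; apply => //.
by rewrite ltr1n.
Qed.

(** The yardstick for all error terms: beyond the crossover each term is at least half its prior
    variance. *)
Lemma risk_series_ge eps S m : 0 < eps ->
  (forall N, \sum_(0 <= k < N) rt eps k <= S) ->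
  (forall k, (m <= k)%N -> snr_ k <= eps ^+ 2) ->
  tail_const * w_ m.+1 <= S.
Proof.
move=> eps0 Sub snrm; have rt0 k : 0 <= rt eps k by exact: risk_term_ge0.
(* This upper end has successor 2 (m + 1), so multiplicativity of [weight] yields the factor 1 - w_
   2. *)
have mm : (m <= 2 * m + 1)%N by rewrite mul2n -addnn -addnA leq_addr.
apply: le_trans (Sub (2 * m + 1)%N).
rewrite (big_cat_nat (m := 0%N) (n := m) (p := (2 * m + 1)%N))//=.
apply: (@le_trans _ _ (\sum_(m <= k < 2 * m + 1) rt eps k)); last first.
  by rewrite lerDr sumr_ge0.
apply: (@le_trans _ _ (\sum_(m <= k < 2 * m + 1) v k / 2)); last first.
  rewrite [leLHS]big_nat_cond [leRHS]big_nat_cond.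
  apply: ler_sum => k; rewrite andbT => /andP[mk _].
  by apply: risk_term_ge_var => //; exact: snrm.
rewrite -mulr_suml.
have := sum_prior_var_ge r_gt0 P0_gt0 mm.
rewrite (_ : (2 * m + 1).+1 = (2 * m.+1)%N); last by rewrite addn1 mulnS addnC addn2.
rewrite weightM /tail_const; lra.
Qed.

(** Budget: low indices, high indices, shrinking the prior by 1 - del, and draws outside the ball
    cost [del] each, and (1 - del) (1 - 2 del) - del >= 1 - 4 del. *)
Lemma minimax_risk_ge_near (del : R) : 0 < del -> del < 1 ->
  exists2 e0 : R, 0 < e0 & forall eps S, 0 < eps -> eps < e0 ->
    (forall N, \sum_(0 <= k < N) rt eps k <= S) ->
    (forall N, (0 < N)%N -> S <= \sum_(0 <= k < N) rt eps k + P0 * w_ N) ->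
    (((1 - 4 * del) * S)%:E <= minimax_risk xi a sigma r P0 eps)%E.
Proof.
move=> del0 del1.
have [Gam Gam0 GamP] := noise_ratio_bounded.
have [kap kap0 kapE] : exists2 k, 0 < k & k = tail_const.
  by exists tail_const => //; exact: tail_const_gt0.
pose q := (Num.truncn (4 * r / del)).+1.
have q0 : (0 < q)%N by [].
have rq : 4 * r <= del * q%:R.
  by rewrite [leRHS]mulrC -ler_pdivrMr// ltW// truncnS_gt.
(* With m >= (L + 1) K, the share 2 Gam K / (m - K) of the low indices is at most 2 Gam / L <=
   del. *)
pose L := (Num.truncn (2 * Gam / del)).+1.
have L0 : 0 < L%:R :> R by rewrite ltr0n.
have GL : 2 * Gam <= del * L%:R.
  by rewrite [leRHS]mulrC -ler_pdivrMr// ltW// truncnS_gt.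
pose M := (q * L.+1)%N.
have M0 : (0 < M)%N by rewrite muln_gt0.
have M20 : (0 < 2 * M)%N by rewrite muln_gt0.
have w2M := weight_gt0 r M20.
(* [Q] is taken so large that the remainder P0 w_ (Q n) is at most [del] times the yardstick. *)
have e1 : 0 < del * kap * w_ (2 * M) / P0 by rewrite divr_gt0// !mulr_gt0.
have [Q1 Q10 wQ1] := weight_small r_gt0 e1.
pose Q := maxn Q1 q.+1.
have qQ : (q < Q)%N by rewrite leq_maxr.
have Q0 : (0 < Q)%N by exact: leq_trans qQ.
have wQ : P0 * w_ Q <= del * kap * w_ (2 * M).
  rewrite [leLHS]mulrC -ler_pdivlMr//; apply: le_trans wQ1.
  by apply: weight_le => //; rewrite leq_maxl.
have wq := weight_gt0 r q0.
(* The splitting level will be rho t. Since V^2 + 128 V2 <= 129 rho^2, the second-moment error is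
   258 rho / t; 516 makes it half of the allowance [del] times the yardstick. *)
pose t := 516 * (P0 * w_ q) / (del * kap * w_ (2 * M)).
have den0 : 0 < del * kap * w_ (2 * M) by rewrite !mulr_gt0.
have t0 : 0 < t.
  by apply: divr_gt0 den0; apply: mulr_gt0; [rewrite ltr0n|exact: mulr_gt0].
pose B := bad_rate r del q Q.
have B0 : 0 <= B by exact: bad_rate_ge0.
(* For n >= z the terms carrying the probability of the bad event fit in the other half of the
   allowance. *)
pose z := 2 * ((8 + 2 * t) * B * (P0 * w_ q)) / (del * kap * w_ (2 * M)).
pose n2 := maxn (Num.truncn z).+1 i0.+1.
pose m0 := (M * n2)%N.
(* Below this noise level the ratio at m0 + i0 + 1 still exceeds eps^2, which forces the crossover
   past m0. *)
exists (Num.sqrt (snr_ (m0 + i0.+1))); first by rewrite sqrtr_gt0 snr_gt0.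
move=> eps S eps0 epse Sub Slb.
have [m [im snrhi snrlo]] := crossover eps0.
have m0m : (m0 <= m)%N.
  rewrite leqNgt; apply/negP => mm0.
  have : snr_ (m0 + i0.+1) <= eps ^+ 2.
    by apply: snrhi; rewrite (leq_trans (ltnW mm0))// leq_addr.
  rewrite leNgt; apply/negP; rewrite negbK.
  rewrite -[ltRHS]sqr_sqrtr ?(ltW (snr_gt0 _))//.
  by rewrite ltr_pXn2r// nnegrE ?sqrtr_ge0 ?(ltW eps0).
pose n := (m %/ M)%N.
have n2n : (n2 <= n)%N by rewrite leq_divRL// mulnC.
have n0 : (0 < n)%N by rewrite (leq_trans _ n2n)// leq_max.
have nR : 0 < n%:R :> R by rewrite ltr0n.
have wn := weight_gt0 r n0.
(* As m < (n + 1) M <= 2 M n, the yardstick at the crossover is at least a fixed multiple of w_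
   n. *)
have Slow : kap * (w_ (2 * M) * w_ n) <= S.
  apply: le_trans (risk_series_ge eps0 Sub snrhi).
  rewrite -kapE ler_wpM2l ?(ltW kap0)// -weightM; apply: weight_le => //.
  have h1 : (m < n.+1 * M)%N by exact: ltn_ceil.
  apply: (leq_trans h1); rewrite mulnC -mulnA mulnCA leq_mul2l.
  by rewrite mul2n -addnn -add1n leq_add2r n0 orbT.
have S0 : 0 <= S.
  by apply: le_trans Slow; rewrite mulr_ge0 ?(ltW kap0)// mulr_ge0// ltW.
have rt0 k : 0 <= rt eps k by exact: risk_term_ge0.
set K := (q * n)%N; set N := (Q * n)%N.
have KN : (K <= N)%N by rewrite leq_mul2r (ltnW qQ) orbT.
have iK : (i0 < K)%N.
  apply: (@leq_trans n); last by rewrite leq_pmull.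
  by apply: leq_trans n2n; rewrite leq_maxr.
have LKm : (L.+1 * K <= m)%N.
  by rewrite /K mulnA [(L.+1 * q)%N]mulnC mulnC leq_trunc_div.
have Km : (K <= m)%N by apply: leq_trans LKm; rewrite leq_pmull.
have low : \sum_(0 <= k < K) rt eps k <= del * S.
  have := low_frequencies eps0 (ltW Gam0) GamP Sub snrlo iK Km.
  have LK : (L * K)%:R <= (m - K)%:R :> R.
    by rewrite ler_nat leq_subRL// -mulSn.
  have K0 : 0 < K%:R :> R by rewrite ltr0n (leq_ltn_trans _ iK).
  have sum0 : 0 <= \sum_(0 <= k < K) rt eps k by apply: sumr_ge0.
  move: sum0 LK; set X := \sum_(_ <= _ < _) _ => X0 LK h.
  have h1 : (L * K)%:R * X <= 2 * Gam * K%:R * S.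
    by apply: le_trans h; rewrite ler_wpM2r.
  have h2 : L%:R * X <= 2 * Gam * S.
    by rewrite -(ler_pM2r K0); move: h1; rewrite natrM; lra.
  have h3 : L%:R * X <= L%:R * (del * S).
    by apply: (le_trans h2); have := ler_wpM2r S0 GL; lra.
  by rewrite ler_pM2l in h3.
have N0 : (0 < N)%N by rewrite muln_gt0 Q0.
have high : S - \sum_(0 <= k < N) rt eps k <= del * S.
  have : P0 * w_ N <= del * S.
    rewrite /N weightM mulrA.
    apply: (@le_trans _ _ (del * kap * w_ (2 * M) * w_ n)).
      by rewrite ler_wpM2r// ltW.
    by have := ler_wpM2l (ltW del0) Slow; lra.
  by have := Slb N N0; lra.
have mid : S - 2 * (del * S) <= \sum_(K <= k < N) rt eps k.
  move: high; rewrite (big_cat_nat (m := 0%N) (n := K) (p := N))//=; lra.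
pose s := block_sd r P0 del q Q n.
have sE k : s k ^+ 2 = block_var r P0 del q Q n k by exact: block_sd2.
(* Shrinking the variance shrinks the denominator of a term too, so each term loses at most the
   factor 1 - del. *)
have bayes : (1 - del) * \sum_(K <= k < N) rt eps k <=
    \sum_(0 <= k < N) (s k ^+ 2 * (eps * sigma k) ^+ 2 /
      (a k ^+ 2 * s k ^+ 2 + (eps * sigma k) ^+ 2)).
  rewrite [leRHS](big_cat_nat (m := 0%N) (n := K) (p := N))//=.
  rewrite -[leLHS]add0r lerD//.
    apply: sumr_ge0 => k _.
    by rewrite -!exprMn divr_ge0 ?addr_ge0 ?sqr_ge0.
  rewrite mulr_sumr [leLHS]big_nat_cond [leRHS]big_nat_cond.
  apply: ler_sum => k; rewrite andbT => Kk.
  rewrite sE /block_var Kk risk_termE//.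
  move: (v k) (prior_var_gt0 r_gt0 P0_gt0 k) => vk v0.
  have e2 : 0 < (eps * sigma k) ^+ 2 by rewrite exprn_gt0// mulr_gt0.
  have av : 0 < a k ^+ 2 * vk by rewrite mulr_gt0.
  have d1 : 0 < 1 - del by rewrite subr_gt0.
  rewrite !mulrA ler_wpM2l//.
    by rewrite !mulr_ge0// ltW.
  rewrite lef_pV2 ?posrE.
  - rewrite lerD2r; have := mulr_gt0 del0 av; lra.
  - exact: addr_gt0.
  - apply: addr_gt0 => //; apply: mulr_gt0 => //; exact: mulr_gt0.
pose rho := P0 * w_ (q * n).
have rho0 : 0 < rho by rewrite mulr_gt0// weight_gt0// muln_gt0 q0.
have rhoE : rho = P0 * w_ q * w_ n by rewrite /rho weightM mulrA.
pose b := rho * t; have b0 : 0 < b by rewrite mulr_gt0.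
have lb := @minimax_lower_bound R d T P xi xi_iid a sigma r P0 eps sigma_gt0 P0_gt0 eps0
  s N (good_event xi r P0 del q Q n) rho (measurable_good_event xi r P0 del q Q n)
  (ltW rho0) (good_event_besov r_gt0 P0_gt0 del1 qQ n0)
  (good_event_norm r_gt0 P0_gt0 del1 q0 qQ n0) b (B / n%:R) b0
  (good_event_prob xi_iid r_gt0 P0_gt0 del0 del1 q0 qQ n0 rq).
apply: le_trans lb; rewrite lee_fin.
set V := \sum_(0 <= k < N) s k ^+ 2; set V2 := \sum_(0 <= k < N) (s k ^+ 2) ^+ 2.
have V0 : 0 <= V by apply: sumr_ge0 => k _; exact: sqr_ge0.
have Vrho : V <= rho.
  rewrite /V; under eq_bigr do rewrite sE.
  exact: sum_block_var.
have VV : V ^+ 2 <= rho ^+ 2 by rewrite ler_pXn2r// nnegrE ltW.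
have V2V : V2 <= rho ^+ 2.
  apply: le_trans VV; rewrite expr2 /V big_distrlr/= /V2.
  rewrite [leLHS]big_nat_cond [leRHS]big_nat_cond.
  apply: ler_sum => k; rewrite andbT => /andP[_ kN].
  rewrite (bigD1_seq k) ?iota_uniq ?mem_index_iota//=.
  by rewrite -expr2 lerDl sumr_ge0// => i _; rewrite mulr_ge0 ?sqr_ge0.
have err : 8 * rho * (B / n%:R) + 2 * (b * (B / n%:R) + (V ^+ 2 + 128 * V2) / b) <= del * S.
  have e2 : (V ^+ 2 + 128 * V2) / b <= 129 * rho / t.
    rewrite ler_pdivrMr// /b (_ : 129 * rho / t * (rho * t) = 129 * rho ^+ 2); last first.
      by field; rewrite gt_eqF.
    lra.
  have e3 : 2 * (129 * rho / t) = del * (kap * (w_ (2 * M) * w_ n)) / 2.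
    by rewrite /t rhoE; field; rewrite !gt_eqF.
  have zn : z <= n%:R.
    apply: (@le_trans _ _ n2%:R); last by rewrite ler_nat.
    apply: (@le_trans _ _ (Num.truncn z).+1%:R); first by rewrite ltW// truncnS_gt.
    by rewrite ler_nat leq_maxl.
  have e4 : (8 + 2 * t) * B / n%:R * rho <= del * (kap * (w_ (2 * M) * w_ n)) / 2.
    rewrite rhoE.
    rewrite (_ : _ * _ = (8 + 2 * t) * B * (P0 * w_ q) / n%:R * w_ n); last by ring.
    rewrite (_ : del * _ / 2 = del * kap * w_ (2 * M) / 2 * w_ n); last by ring.
    rewrite ler_wpM2r ?(ltW wn)// ler_pdivrMr//.
    move: zn; rewrite /z ler_pdivrMr//; lra.
  have h := ler_wpM2l (ltW del0) Slow.
  rewrite (_ : 8 * rho * (B / n%:R) + _ = (8 + 2 * t) * B / n%:R * rho +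
    2 * ((V ^+ 2 + 128 * V2) / b)); last by rewrite /b; ring.
  lra.
have m1 : (1 - del) * (S - 2 * (del * S)) <= (1 - del) * \sum_(K <= k < N) rt eps k.
  by rewrite ler_wpM2l// subr_ge0 ltW.
apply: (@le_trans _ _ ((1 - del) * (S - 2 * (del * S)) - del * S)); last first.
  by apply: lerB => //; exact: le_trans m1 bayes.
have : 0 <= del * del * S by rewrite !mulr_ge0// ltW.
lra.
Qed.

End lower_asymptotics.

(** * Risk of the Tikhonov rule *)

(* Summation by parts: only the tail sums of [z] enter, because [g] is nondecreasing. *)
Lemma sum_monotone_weight (R : realType) (g z : nat -> R) (m n : nat) (G e : R) :
  (m <= n)%N -> 0 <= e -> (forall k, 0 <= g k <= G) ->
  (forall k, (m <= k)%N -> g k <= g k.+1) ->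
  (forall j, (m <= j <= n)%N -> \sum_(j <= k < n) z k <= e) ->
  \sum_(m <= k < n) g k * z k <= G * e.
Proof.
move=> mn e0 g0 gmono tails.
(* Induction downwards from [n]. The bound is affine in the current weight, and lowering that weight
   can only raise it, because the tail sum is at most [e]. *)
have key i : (i <= n - m)%N ->
    \sum_(n - i <= k < n) g k * z k <= (G - g (n - i)%N) * e + g (n - i)%N * \sum_(n - i <= k < n) z k.
  elim: i => [_|i IH im].
    rewrite subn0 !big_geq// mulr0 addr0 mulr_ge0// subr_ge0.
    by have /andP[] := g0 n.
  have ni : (n - i = (n - i.+1).+1)%N by rewrite -subSn ?subSS// (leq_trans im)// leq_subr.
  have lt : (n - i.+1 < n)%N by rewrite -ni leq_subr.
  rewrite (big_ltn lt) [in leRHS](big_ltn lt) -ni.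
  have h := IH (ltnW im).
  have mj : (m <= n - i.+1)%N.
    by rewrite leq_subRL ?(leq_trans im) ?leq_subr// addnC -leq_subRL.
  have h1 := gmono _ mj; rewrite -ni in h1.
  have h2 : \sum_(n - i <= k < n) z k <= e.
    by apply: tails; rewrite leq_subr andbT ni ltnW// ltnS.
  have h3 : 0 <= (g (n - i)%N - g (n - i.+1)%N) * (e - \sum_(n - i <= k < n) z k).
    by rewrite mulr_ge0// subr_ge0.
  lra.
have := key (n - m)%N (leqnn _); rewrite subKn// => /le_trans; apply.
have := tails m; rewrite leqnn mn => /(_ isT) t.
have /andP[gm _] := g0 m; have := ler_wpM2l gm t; lra.
Qed.

Section tikhonov_risk.
Context {R : realType} {d : measure_display} {T : measurableType d}.
Context (P : probability T R) (xi : nat -> {RV P >-> R}).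
Variables (a sigma : nat -> R) (r P0 : R).
Hypotheses (xi_iid : iid_standard_gaussian xi)
    (a_neq0 : forall i, a i != 0)
    (sigma_gt0 : forall i, 0 < sigma i)
    (r_gt0 : 0 < r) (P0_gt0 : 0 < P0).
Local Notation w_ := (weight r).
Local Notation v := (prior_var r P0).
Local Notation rt := (risk_term a sigma r P0).
Local Notation snr_ := (snr a sigma r P0).
Local Notation den := (tikhonov_denom a sigma r P0).
Local Notation tik := (tikhonov a sigma r P0).

Definition bias eps k : R := 1 - a k ^+ 2 / den eps k.
Definition noise_gain eps k : R := a k * (eps * sigma k) / den eps k.

Let den_gt0 eps k : 0 < den eps k.
Proof. exact: tikhonov_denom_gt0. Qed.

(** The risk in one coordinate is affine in x_k^2, and at x_k^2 = v_k it is the Bayes risk. Hence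
    the excess over the limiting risk is the sum of bias^2 (x_k^2 - v_k). *)
Lemma bias_noise_gain eps k : bias eps k ^+ 2 * v k + noise_gain eps k ^+ 2 = rt eps k.
Proof.
have v0 := prior_var_gt0 r_gt0 P0_gt0 k.
have a2 : 0 < a k ^+ 2 by rewrite exprn_even_gt0/=.
have := den_gt0 eps k.
rewrite /bias /noise_gain /risk_term tikhonov_denomE//.
move: (v k) v0 => vk v0 D0; field.
have -> : a k ^+ 2 * vk + (eps * sigma k) ^+ 2 = (a k ^+ 2 + (eps * sigma k) ^+ 2 / vk) * vk.
  by field; rewrite gt_eqF.
by rewrite mulf_neq0 ?gt_eqF.
Qed.

(** In this form the bias visibly increases as the signal-to-noise ratio decreases. *)
Lemma bias_snr eps k : 0 < eps -> bias eps k = eps ^+ 2 / (eps ^+ 2 + snr_ k).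
Proof.
move=> eps0; have v0 := prior_var_gt0 r_gt0 P0_gt0 k.
have a2 : 0 < a k ^+ 2 by rewrite exprn_even_gt0/=.
have s0 := sigma_gt0 k.
rewrite /bias tikhonov_denomE// /snr; move: (v k) v0 => vk v0.
have e2 : 0 < eps ^+ 2 * sigma k ^+ 2 by rewrite mulr_gt0// exprn_gt0.
have av : 0 < a k ^+ 2 * vk by rewrite mulr_gt0.
rewrite exprMn; field.
by rewrite !gt_eqF//= ?addr_gt0//; lra.
Qed.

Lemma bias_ge0 eps k : 0 < eps -> 0 <= bias eps k.
Proof.
move=> eps0; have s0 : 0 < snr_ k.
  by rewrite divr_gt0 ?exprn_gt0// mulr_gt0 ?prior_var_gt0// exprn_even_gt0/=.
by rewrite bias_snr// divr_ge0 ?sqr_ge0// addr_ge0 ?sqr_ge0// ltW.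
Qed.

Lemma bias_le1 eps k : bias eps k <= 1.
Proof. by rewrite gerBl divr_ge0 ?sqr_ge0 ?(ltW (den_gt0 _ _)). Qed.

Lemma bias_le eps k : 0 < eps -> bias eps k <= eps ^+ 2 / snr_ k.
Proof.
move=> eps0; have s0 : 0 < snr_ k.
  by rewrite divr_gt0 ?exprn_gt0// mulr_gt0 ?prior_var_gt0// exprn_even_gt0/=.
rewrite bias_snr// ler_wpM2l ?sqr_ge0// lef_pV2 ?posrE ?addr_gt0 ?exprn_gt0//.
by rewrite lerDr sqr_ge0.
Qed.

Lemma tikhonov_coord eps (x : nat -> R) w i :
  tik eps (observation xi a sigma eps x w) i =
  (1 - bias eps i) * x i + noise_gain eps i * noise xi w i.
Proof.
rewrite /tikhonov /observation /noise /bias /noise_gain.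
by field; rewrite a_neq0 gt_eqF.
Qed.

Let measurable_affine_noise (p q : R) i :
  measurable_fun setT (fun w => ((p + q * noise xi w i) ^+ 2)%:E).
Proof.
apply/measurable_EFinP; apply: (measurableT_comp (exprn_measurable 2)).
by apply: measurable_funD => //; apply: measurable_funM => //; exact: measurable_noise_coord.
Qed.

Let integral_affine_noise (p q : nat -> R) :
  (\int[P]_w (\sum_(0 <= i <oo) ((p i + q i * noise xi w i) ^+ 2)%:E) =
   \sum_(0 <= i <oo) (p i ^+ 2 + q i ^+ 2)%:E)%E.
Proof.
rewrite integral_nneseries//; last first.
  by move=> i w _; rewrite lee_fin sqr_ge0.
apply: eq_eseriesr => i _.
have mf : measurable_fun setT (fun u : R => ((p i + q i * u) ^+ 2)%:E).
  apply/measurable_EFinP; apply: (measurableT_comp (exprn_measurable 2)).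
  by apply: measurable_funD => //; exact: measurable_funM.
rewrite (noise_marginal xi_iid i mf); last by move=> u; rewrite lee_fin sqr_ge0.
exact: integral_normal_affine_sqr.
Qed.

Lemma tikhonov_riskE eps x : (risk xi a sigma eps (tik eps) x =
  \sum_(0 <= i <oo) ((bias eps i * x i) ^+ 2 + noise_gain eps i ^+ 2)%:E)%E.
Proof.
transitivity (\sum_(0 <= i <oo) ((- (bias eps i * x i)) ^+ 2 + noise_gain eps i ^+ 2)%:E)%E; last first.
  by apply: eq_eseriesr => i _; rewrite sqrrN.
rewrite -integral_affine_noise /risk /sqnorm.
apply: eq_integral => w _; apply: eq_eseriesr => i _.
by rewrite tikhonov_coord; congr (_ ^+ 2)%:E; ring.
Qed.

(** The expected squared norm is finite: the signal is contracted and the noise part of each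
    coordinate is at most its [risk_term], which is summable. *)
Lemma tikhonov_ae_finite eps x : ell2 x ->
  {ae P, forall w, ell2 (tik eps (observation xi a sigma eps x w) : nat -> R)}.
Proof.
move=> x2.
have mS : measurable_fun setT (fun w => sqnorm (tik eps (observation xi a sigma eps x w))).
  rewrite /sqnorm.
  have -> : (fun w => \sum_(0 <= i <oo) (tik eps (observation xi a sigma eps x w) i ^+ 2)%:E)%E =
    (fun w => \sum_(0 <= i <oo) (((1 - bias eps i) * x i + noise_gain eps i * noise xi w i) ^+ 2)%:E)%E.
    by apply/funext => w; apply: eq_eseriesr => i _; rewrite tikhonov_coord.
  apply: ge0_emeasurable_sum => // i w _ _.
  by rewrite lee_fin sqr_ge0.
have fin : (\int[P]_w sqnorm (tik eps (observation xi a sigma eps x w)) < +oo)%E.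
  have -> : (\int[P]_w sqnorm (tik eps (observation xi a sigma eps x w)) =
      \sum_(0 <= i <oo) (((1 - bias eps i) * x i) ^+ 2 + noise_gain eps i ^+ 2)%:E)%E.
    rewrite -integral_affine_noise; apply: eq_integral => w _.
    by apply: eq_eseriesr => i _; rewrite tikhonov_coord.
  have [S [_ SE _ _]] := risk_series sigma a_neq0 r_gt0 P0_gt0 eps.
  apply: (@le_lt_trans _ _ (sqnorm x + S%:E)%E); last by rewrite lte_add_pinfty// ltry.
  rewrite -SE /sqnorm -nneseriesD.
  - apply: lee_nneseries => [i _ _|i _].
      by rewrite lee_fin addr_ge0 ?sqr_ge0.
    rewrite -EFinD lee_fin lerD//.
      rewrite exprMn ler_piMl ?sqr_ge0// exprn_ile1// /bias subKr.
        by rewrite divr_ge0 ?sqr_ge0// ltW.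
      rewrite ler_pdivrMr// mul1r tikhonov_denomE// lerDl.
      by rewrite divr_ge0 ?sqr_ge0// ltW// prior_var_gt0.
    rewrite -bias_noise_gain lerDr mulr_ge0 ?sqr_ge0//.
    by rewrite ltW// prior_var_gt0.
  - by move=> i _ _; rewrite lee_fin sqr_ge0.
  - by move=> i _ _; rewrite lee_fin risk_term_ge0.
have int : P.-integrable setT (fun w => sqnorm (tik eps (observation xi a sigma eps x w))).
  apply/integrableP; split => //.
  rewrite (eq_integral (fun w => sqnorm (tik eps (observation xi a sigma eps x w))))// => w _.
  by rewrite gee0_abs//; apply: nneseries_ge0 => i _ _; rewrite lee_fin sqr_ge0.
have := integrable_ae measurableT int.
apply: filterS => w /(_ Logic.I); rewrite /ell2/=.
by rewrite fin_numE => /andP[_]; rewrite ltey.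
Qed.

End tikhonov_risk.

(** * Worst-case risk of the Tikhonov rule over the ball *)

Section upper_bound.
Context {R : realType} {d : measure_display} {T : measurableType d}.
Context (P : probability T R) (xi : nat -> {RV P >-> R}).
Variables (a sigma : nat -> R) (r P0 : R) (i0 : nat).
Hypotheses (xi_iid : iid_standard_gaussian xi)
    (a_neq0 : forall i, a i != 0)
    (sigma_gt0 : forall i, 0 < sigma i)
    (r_gt0 : 0 < r) (P0_gt0 : 0 < P0)
    (ratio_gt1 : forall i, (i0 < i)%N ->
      1 < (sigma i ^+ 2 * a i.-1 ^+ 2 * i.+1%:R `^ (2 * r + 1)) /
          (sigma i.-1 ^+ 2 * a i ^+ 2 * i%:R `^ (2 * r + 1))).
Local Notation w_ := (weight r).
Local Notation v := (prior_var r P0).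
Local Notation rt := (risk_term a sigma r P0).
Local Notation snr_ := (snr a sigma r P0).
Local Notation tik := (tikhonov a sigma r P0).
Local Notation bias := (bias a sigma r P0).
Local Notation noise_gain := (noise_gain a sigma r P0).

(** An estimator must land in [ell2] for every data sequence; zero is the default where the Tikhonov
    rule does not. *)
Definition tikhonov_estimator (eps : R) (y : seq_space R) : seq_space R :=
  if (sqnorm (tik eps y) < +oo)%E then tik eps y else (fun=> 0).

Lemma tikhonov_estimatorP eps : estimators (tikhonov_estimator eps).
Proof.
have mtik n : measurable_fun setT (fun y : seq_space R => tik eps y n).
  by apply: measurable_funM => //; exact: measurable_coord.
split; last first.
  move=> y; rewrite /tikhonov_estimator; case: ifPn => // _.
  by rewrite /ell2/= /sqnorm eseries0 ?ltry// => i _ _; rewrite expr0n.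
apply: measurable_fun_seq => n.
rewrite (_ : (fun _ => _) =
    (fun y => if (sqnorm (tik eps y) < +oo)%E then tik eps y n else 0)); last first.
  by apply/funext => y; rewrite /tikhonov_estimator; case: ifP.
apply: measurable_fun_ifT => //.
apply: measurable_fun_lte => //.
apply: ge0_emeasurable_sum => [i y _ _|i _]; first by rewrite lee_fin sqr_ge0.
by apply/measurable_EFinP; exact: (measurableT_comp (exprn_measurable 2)).
Qed.

Lemma tikhonov_estimator_ae eps x : ell2 x ->
  {ae P, forall w, tikhonov_estimator eps (observation xi a sigma eps x w) =
     tik eps (observation xi a sigma eps x w)}.
Proof.
move=> /(tikhonov_ae_finite sigma xi_iid a_neq0 r_gt0 P0_gt0 eps).
by apply: filterS => w fin; rewrite /tikhonov_estimator fin.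
Qed.

Lemma besov_ball_tail x k : besov_ball r P0 x ->
  (\sum_(k <= i <oo) (x i ^+ 2)%:E <= (P0 * w_ k.+1)%:E)%E.
Proof.
move=> xB.
have kR : 0 < k.+1%:R `^ (2 * r) :> R by rewrite powR_gt0.
have : ((k.+1%:R `^ (2 * r))%:E * \sum_(k <= i <oo) (x i ^+ 2)%:E <= P0%:E)%E.
  by apply: le_trans xB; apply: ereal_sup_ubound; exists k.
by rewrite muleC -lee_pdivlMr// /weight mulrC EFinM.
Qed.

Lemma besov_ball_sum x k n : besov_ball r P0 x -> \sum_(k <= i < n) x i ^+ 2 <= P0 * w_ k.+1.
Proof.
move=> xB; rewrite -lee_fin -sumEFin; apply: le_trans (besov_ball_tail k xB).
by apply: nneseries_lim_ge => i _ _; rewrite lee_fin sqr_ge0.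
Qed.

Lemma besov_ball_ell2 x : besov_ball r P0 x -> ell2 x.
Proof. by move=> /(besov_ball_tail 0) /le_lt_trans; apply; rewrite ltry. Qed.

(** The infimum ranges over estimators only, so it is compared with [tikhonov_estimator], whose risk
    equals that of the Tikhonov rule at every point of the ball. *)
Lemma minimax_le_tikhonov eps :
  (minimax_risk xi a sigma r P0 eps <= sup_risk xi a sigma r P0 eps (tik eps))%E.
Proof.
apply: (@le_trans _ _ (sup_risk xi a sigma r P0 eps (tikhonov_estimator eps))).
  by apply: ereal_inf_lbound; exists (tikhonov_estimator eps) => //; exact: tikhonov_estimatorP.
apply: ge_ereal_sup => _ [x xB <-].
apply: (@le_trans _ _ (risk xi a sigma eps (tik eps) x)); last first.
  by apply: ereal_sup_ubound; exists x.
have mrisk (delta : seq_space R -> seq_space R) :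
    (forall n, measurable_fun setT (fun y => delta y n)) ->
    measurable_fun setT (fun w => sqnorm (fun i => delta (observation xi a sigma eps x w) i - x i)).
  move=> mdelta; apply: ge0_emeasurable_sum => [i w _ _|i _]; first by rewrite lee_fin sqr_ge0.
  apply/measurable_EFinP; apply: (measurableT_comp (exprn_measurable 2)).
  apply: measurable_funB => //; apply: (measurableT_comp (mdelta i)).
  apply: measurable_fun_seq => n; apply: measurable_funD => //.
  by apply: measurable_funM => //; exact: measurable_noise_coord.
have pos (delta : seq_space R -> seq_space R) w :
    (0 <= sqnorm (fun i => delta (observation xi a sigma eps x w) i - x i)%R)%E.
  by apply: nneseries_ge0 => i _ _; rewrite lee_fin sqr_ge0.
rewrite le_eqVlt; apply/orP; left; apply/eqP.
apply: ge0_ae_eq_integral => //.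
- apply: mrisk => n; apply: (measurableT_comp (measurable_coord n)).
  by have [] := tikhonov_estimatorP eps.
- by apply: mrisk => n; apply: measurable_funM => //; exact: measurable_coord.
- have := tikhonov_estimator_ae eps (besov_ball_ell2 xB).
  by apply: filterS => w e _; rewrite e.
Qed.

(** Cost of the coordinates where the bias need not be monotone: there bias^2 <= (eps^2 / snr)^2 and
    x_k^2 <= P0. *)
Definition bias_const : R := P0 * \sum_(0 <= k < i0) (snr_ k)^-1 ^+ 2.

Lemma sup_risk_tikhonov_le eps S : 0 < eps ->
  (forall N, \sum_(0 <= k < N) rt eps k <= S) ->
  (sup_risk xi a sigma r P0 eps (tik eps) <= (S + bias_const * eps ^+ 4)%:E)%E.
Proof.
move=> eps0 Sub; apply: ge_ereal_sup => _ [x xB <-].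
rewrite tikhonov_riskE//.
pose u k := (bias eps k * x k) ^+ 2 + noise_gain eps k ^+ 2.
have u0 k : 0 <= u k by rewrite addr_ge0 ?sqr_ge0.
apply: (@nneseries_ub _ u 0) => // n.
have s0 k : 0 < snr_ k by exact: snr_gt0.
have b0 k : 0 <= bias eps k by exact: bias_ge0.
have b1 k : bias eps k <= 1 by exact: bias_le1.
(* Cutting at a finite [N] discards the tail of [prior_var], which could have offset part of the
   bias; this costs the last term, removed by letting [N] grow. *)
have step N : (n <= N)%N -> (i0 <= N)%N ->
    \sum_(0 <= k < n) u k <= S + bias_const * eps ^+ 4 + P0 * w_ N.+1.
  move=> nN iN; apply: (@le_trans _ _ (\sum_(0 <= k < N) u k)).
    by rewrite [leRHS](big_cat_nat (m := 0%N) (n := n) (p := N))//= lerDl sumr_ge0.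
  have -> : \sum_(0 <= k < N) u k = \sum_(0 <= k < N) rt eps k +
      \sum_(0 <= k < N) bias eps k ^+ 2 * (x k ^+ 2 - v k).
    rewrite -big_split/=; apply: eq_bigr => k _.
    by rewrite /u -bias_noise_gain// exprMn; ring.
  rewrite -addrA lerD//.
  rewrite (big_cat_nat (m := 0%N) (n := i0) (p := N))//=; apply: lerD.
    rewrite /bias_const mulrAC mulr_sumr [leLHS]big_nat_cond [leRHS]big_nat_cond.
    apply: ler_sum => k _.
    have xP : x k ^+ 2 <= P0.
      have := besov_ball_sum k k.+1 xB; rewrite big_nat1 => /le_trans; apply.
      rewrite ler_piMr ?(ltW P0_gt0)//.
      by have := weight_le r_gt0 (ltn0Sn 0) (ltn0Sn k); rewrite /weight powR1 invr1.
    have v0 := prior_var_gt0 r_gt0 P0_gt0 k.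
    apply: (@le_trans _ _ (bias eps k ^+ 2 * P0)).
      by rewrite ler_wpM2l ?sqr_ge0//; lra.
    have : bias eps k ^+ 2 <= (eps ^+ 2 / snr_ k) ^+ 2.
      have hb := bias_le a_neq0 sigma_gt0 r_gt0 P0_gt0 k eps0.
      by rewrite ler_pXn2r// nnegrE// (le_trans (b0 k) hb).
    rewrite -(ler_pM2r P0_gt0) => /le_trans; apply.
    by rewrite exprMn -exprM; lra.
  rewrite -[leRHS]mul1r.
  apply: (sum_monotone_weight (g := fun k => bias eps k ^+ 2)) => //.
  - by rewrite mulr_ge0 ?(ltW P0_gt0)// ltW// weight_gt0.
  - by move=> k; rewrite sqr_ge0 exprn_ile1.
  - move=> k ik; rewrite ler_pXn2r ?nnegrE//.
    rewrite !bias_snr// ler_wpM2l ?sqr_ge0// lef_pV2 ?posrE ?addr_gt0 ?exprn_gt0//.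
    by rewrite lerD2l; apply: (snr_le _ _ _ _ ratio_gt1).
  (* The ball bounds the sum of the x_k^2 by P0 w_ j.+1; that of the variances falls short of this
     value by at most P0 w_ N.+1. *)
  - move=> j /andP[_ jN]; rewrite sumrB.
    have := sum_prior_var_ge r_gt0 P0_gt0 jN.
    have := besov_ball_sum j N xB; lra.
apply/ler_addgt0Pr => e e0.
have [N N0 wN] := weight_small r_gt0 (divr_gt0 e0 P0_gt0).
pose M := maxn N (maxn n i0).
apply: (le_trans (step M _ _)).
- by rewrite /M !leq_max leqnn orbT.
- by rewrite /M !leq_max leqnn !orbT.
rewrite lerD2l mulrC -ler_pdivlMr//; apply: le_trans wN.
by apply: weight_le => //; rewrite leqW// leq_maxl.
Qed.

End upper_bound.

(** * From uniform relative errors to the asymptotic statements *)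

Lemma asymp_eqP (R : realType) (F G : R -> \bar R) :
  (forall e : R, 0 < e -> e < 1 -> \forall eps \near 0^'+, exists f g : R,
    [/\ F eps = f%:E, G eps = g%:E, 0 < g & `|f - g| <= e * g]) ->
  asymp_eq F G.
Proof.
move=> FG; exists (fun eps => fine (F eps) / fine (G eps) - 1).
  apply/cvgrPdist_le => e e0.
  (* The hypothesis only covers tolerances below 1, so a larger one is capped. *)
  have e'0 : 0 < Num.min e (1 / 2) by rewrite lt_min e0/=; lra.
  have e'1 : Num.min e (1 / 2) < 1 by rewrite gt_min; apply/orP; right; lra.
  apply: filterS (FG _ e'0 e'1) => eps [f [g [-> -> g0 fg]]] /=.
  rewrite sub0r normrN.
  have -> : f / g - 1 = (f - g) / g by field; rewrite gt_eqF.
  rewrite normrM normfV (gtr0_norm g0) ler_pdivrMr//.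
  by apply: (le_trans fg); rewrite ler_wpM2r ?(ltW g0)// ge_min lexx.
have := FG (1 / 2) ltac:(lra) ltac:(lra).
apply: filterS => eps [f [g [-> -> g0 _]]] /=.
by rewrite -EFinM; congr (_%:E); field; rewrite gt_eqF.
Qed.

Theorem theorem2p2 (R : realType) (d : measure_display) (T : measurableType d)
    (P : probability T R) (xi : nat -> {RV P >-> R}) (a sigma : nat -> R)
    (r P0 : R) (i0 : nat) (c C : R)
    (xi_iid : iid_standard_gaussian xi)
    (a_bounded : bounded_fun a)
    (a_neq0 : forall i, a i != 0)
    (sigma_gt0 : forall i, 0 < sigma i)
    (r_gt0 : 0 < r) (P0_gt0 : 0 < P0)
    (a_decr : forall i, (i0 < i)%N -> 1 <= `|a i / a i.+1|)
    (c_gt0 : 0 < c)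
    (sigma_bounds : forall i, c < sigma i ^+ 2 < C)
    (ratio_gt1 : forall i, (i0 < i)%N ->
      1 < (sigma i ^+ 2 * a i.-1 ^+ 2 * i.+1%:R `^ (2 * r + 1)) /
          (sigma i.-1 ^+ 2 * a i ^+ 2 * i%:R `^ (2 * r + 1))) :
  [/\ (* the Tikhonov rule, which is H-valued only almost surely, agrees
        almost surely with an estimator *)
      forall eps : R, 0 < eps ->
        exists2 delta : seq_space R -> seq_space R, estimators delta &
          forall x : nat -> R, ell2 x ->
            {ae P, forall w, delta (observation xi a sigma eps x w) =
              tikhonov a sigma r P0 eps (observation xi a sigma eps x w)},
      asymp_eq
        (fun eps => sup_risk xi a sigma r P0 eps (tikhonov a sigma r P0 eps))
        (fun eps => minimax_risk xi a sigma r P0 eps)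
    & asymp_eq
        (fun eps => minimax_risk xi a sigma r P0 eps)
        (fun eps => ((eps ^+ 2)%:E * \sum_(0 <= i <oo)
          (sigma i ^+ 2 / tikhonov_denom a sigma r P0 eps i)%:E)%E)].
Proof.
have part1 eps : 0 < eps -> exists2 delta : seq_space R -> seq_space R, estimators delta &
    forall x : nat -> R, ell2 x ->
      {ae P, forall w, delta (observation xi a sigma eps x w) =
         tikhonov a sigma r P0 eps (observation xi a sigma eps x w)}.
  move=> _; exists (tikhonov_estimator a sigma r P0 eps).
    exact: tikhonov_estimatorP.
  by move=> x; exact: tikhonov_estimator_ae.
pose D := bias_const a sigma r P0 i0.
have D0 : 0 <= D by rewrite mulr_ge0 ?(ltW P0_gt0)// sumr_ge0// => k _; exact: sqr_ge0.
(* The first term of the limiting risk at eps = 1. For eps < 1 it gives S >= eps^2 t0, which absorbs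
   the eps^4 error of the upper bound. *)
pose t0 := prior_var r P0 0 * sigma 0%N ^+ 2 / (a 0%N ^+ 2 * prior_var r P0 0 + sigma 0%N ^+ 2).
have v0 := prior_var_gt0 r_gt0 P0_gt0 0.
have t0_gt0 : 0 < t0.
  apply: divr_gt0; first by rewrite mulr_gt0// exprn_gt0.
  by apply: addr_gt0; [apply: mulr_gt0 => //; rewrite exprn_even_gt0/=|rewrite exprn_gt0].
(* Both asymptotic relations follow from one chain of inequalities, which also makes the two risks
   finite. *)
have sandwich (e : R) : 0 < e -> e < 1 -> \forall eps \near 0^'+, exists S m t : R,
    [/\ ((eps ^+ 2)%:E * \sum_(0 <= i <oo)
          (sigma i ^+ 2 / tikhonov_denom a sigma r P0 eps i)%:E)%E = S%:E,
        minimax_risk xi a sigma r P0 eps = m%:E,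
        sup_risk xi a sigma r P0 eps (tikhonov a sigma r P0 eps) = t%:E,
        0 < S & [/\ (1 - e) * S <= m, m <= t & t <= (1 + e) * S]].
  move=> e0 e1.
  have [e' e'0 lower] := minimax_risk_ge_near xi_iid a_bounded a_neq0 sigma_gt0 r_gt0 P0_gt0
    a_decr c_gt0 sigma_bounds ratio_gt1 (del := e / 4) ltac:(lra) ltac:(lra).
  (* Below this level D eps <= e t0; the added 1 keeps the quotient meaningful when [D] vanishes. *)
  pose e'' := e * t0 / (D + 1).
  have e''0 : 0 < e'' by apply: divr_gt0; [exact: mulr_gt0|rewrite ltr_wpDl].
  near=> eps.
  have eps0 : 0 < eps by [].
  have eps1 : eps < 1 by near: eps; exact: nbhs_right_lt.
  have epse' : eps < e' by near: eps; exact: nbhs_right_lt.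
  have epse'' : eps < e'' by near: eps; exact: nbhs_right_lt.
  have [S [SE _ Sub Slb]] := risk_series sigma a_neq0 r_gt0 P0_gt0 eps.
  have Slow : eps ^+ 2 * t0 <= S.
    apply: le_trans (Sub 1%N); rewrite big_nat1 risk_termE// exprMn /t0.
    move: (prior_var r P0 0) v0 => v v0.
    have a2 : 0 < a 0%N ^+ 2 by rewrite exprn_even_gt0/=.
    have s2 : 0 < sigma 0%N ^+ 2 by rewrite exprn_gt0.
    have e2 : 0 < eps ^+ 2 by rewrite exprn_gt0.
    have av : 0 < a 0%N ^+ 2 * v by rewrite mulr_gt0.
    rewrite (_ : eps ^+ 2 * _ = v * (eps ^+ 2 * sigma 0%N ^+ 2) /
      (a 0%N ^+ 2 * v + sigma 0%N ^+ 2)); last by rewrite mulrA mulrCA.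
    apply: ler_wpM2l; first by rewrite ltW// !mulr_gt0.
    rewrite lef_pV2 ?posrE; last 2 first.
    - exact: addr_gt0.
    - by apply: addr_gt0 => //; exact: mulr_gt0.
    by rewrite lerD2l ler_piMl ?(ltW s2)// exprn_ile1// ltW.
  have S0 : 0 < S by apply: lt_le_trans Slow; rewrite mulr_gt0// exprn_gt0.
  have up : D * eps ^+ 4 <= e * S.
    have De : D * eps <= e * t0.
      have : eps * (D + 1) < e * t0 by rewrite -ltr_pdivlMr// ltr_wpDl.
      lra.
    apply: (@le_trans _ _ (e * (eps ^+ 2 * t0))); last by rewrite ler_wpM2l// ltW.
    have h : eps ^+ 4 <= eps * eps ^+ 2.
      rewrite -exprS (exprSr _ 3) ler_piMr ?exprn_ge0// ltW//.
    have := ler_wpM2l D0 h; have := ler_wpM2r (sqr_ge0 eps) De; lra.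
  have ub := sup_risk_tikhonov_le xi_iid a_neq0 sigma_gt0 r_gt0 P0_gt0 ratio_gt1 eps0 Sub.
  have lb := lower eps S eps0 epse' Sub Slb.
  have mid := minimax_le_tikhonov sigma xi_iid a_neq0 r_gt0 P0_gt0 eps.
  move: lb mid ub; rewrite -/D.
  case: (minimax_risk _ _ _ _ _ _) => [m|_|//]; case: (sup_risk _ _ _ _ _ _ _) => [t|//|//]//.
  rewrite !lee_fin => lb mid ub.
  by exists S, m, t; split => //; split => //; lra.
split.
- exact: part1.
- apply: asymp_eqP => e e0 e1.
  (* The relative error is now measured against [m] instead of [S]: t - m <= (e / 2) S <= e m, as m
     >= (1 - e / 4) S. *)
  have := sandwich (e / 4) ltac:(lra) ltac:(lra); apply: filterS => eps [S [m [t [_ mE tE S0 [lb mid ub]]]]].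
  exists t, m; split => //; first by nra.
  rewrite ger0_norm ?subr_ge0//; nra.
- apply: asymp_eqP => e e0 e1.
  have := sandwich e e0 e1; apply: filterS => eps [S [m [t [SE mE _ S0 [lb mid ub]]]]].
  exists m, S; split => //.
  by rewrite ler_norml; apply/andP; split; lra.
Unshelve. all: by end_near. Qed.
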